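(* Let $X_1$, $X_2$ and $Y$ be Banach spaces. Let $A_1:\mathcal{D}(A_1)\subset X_1\to X_1$ and $A_2:\mathcal{D}(A_2)\subset X_2\to X_2$ generate strongly continuous semigroups $T_1(t)$ and $T_2(t)$ that are polynomially stable with $\alpha_1>0$ and $\alpha_2>0$, respectively. Let $B\in\mathcal{L}(Y,X_1)$ and $C\in\mathcal{L}(X_2,Y)$ satisfy $\mathcal{R}(B)\subset\mathcal{D}((-A_1)^{\beta})$ and $\mathcal{R}(C^\ast)\subset\mathcal{D}((-A_2^\ast)^{\gamma})$ for some $\beta,\gamma\geq 0$. Let $T(t)$ be the semigroup generated on $X=X_1\times X_2$ by $$A=\begin{pmatrix}A_1&BC\\0&A_2\end{pmatrix},\qquad \mathcal{D}(A)=\mathcal{D}(A_1)\times\mathcal{D}(A_2).$$ If $\beta/\alpha_1+\gamma/\alpha_2>1$, then $T(t)$ is strongly stable, and with $\alpha=\alpha_1+\alpha_2$ there exist $M\geq1$ and $t_0>1$ such that $$\|T(t)A^{-1}\|\leq M\left(\frac{\ln t}{t}\right)^{1/\alpha}\qquad\text{for all } t\geq t_0.$$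
   Context: $\mathcal{D}(\cdot)$ and $\mathcal{R}(\cdot)$ denote domain and range, $\rho(\cdot)$ the resolvent set, and $\mathcal{L}(X,Y)$ the bounded linear operators from $X$ to $Y$; adjoints on Banach spaces are the dual operators. A strongly continuous semigroup $T(t)$ with generator $A$ on a Banach space is polynomially stable with $\alpha>0$ if $T(t)$ is uniformly bounded ($\sup_{t\ge0}\|T(t)\|<\infty$), $i\mathbb{R}\subset\rho(A)$, and there exists $M\geq1$ such that $\|T(t)A^{-1}\|\leq M t^{-1/\alpha}$ for all $t>0$. For such a generator, $-A$ and $-A^\ast$ are sectorial operators, and $(-A)^\beta$, $(-A^\ast)^\beta$ ($\beta\geq0$) denote their fractional powers. A semigroup $T(t)$ is strongly stable if $T(t)x\to0$ as $t\to\infty$ for every $x$. *)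

(* Defs.v *)
From Stdlib Require Import Reals Lra.
From Stdlib Require Import FunctionalExtensionality ProofIrrelevance.
From Coquelicot Require Import Coquelicot.

Open Scope R_scope.

(* Scalars are complex; a Banach space is a [CompleteNormedModule C_AbsRing]. *)
Notation CNormed := (NormedModule C_AbsRing).

Record blin (U V : CNormed) : Type := Blin
  { bfun :> U -> V; blin_linear : is_linear bfun }.

Arguments Blin {U V} bfun blin_linear.
Arguments bfun {U V} b _.
Arguments blin_linear {U V} b.

Lemma blin_eq {U V : CNormed} (f g : blin U V) : (forall x, f x = g x) -> f = g.
Proof.
  destruct f as [f Hf], g as [g Hg]; simpl; intros H.
  assert (E : f = g) by (apply functional_extensionality; exact H).
  subst g; f_equal; apply proof_irrelevance.
Qed.

Section BlinModule.
Context {U V : CNormed}.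

Lemma blin_plus_linear (f g : blin U V) : is_linear (fun x => plus (f x) (g x)).
Proof.
  apply (is_linear_comp (fun x => (f x, g x)) (fun p => plus (fst p) (snd p))).
  - apply is_linear_prod; apply blin_linear.
  - apply is_linear_plus.
Qed.

Lemma blin_opp_linear (f : blin U V) : is_linear (fun x => opp (f x)).
Proof.
  apply (is_linear_comp (fun x => f x) opp).
  - apply blin_linear.
  - apply is_linear_opp.
Qed.

Lemma blin_scal_linear (k : C_AbsRing) (f : blin U V) :
  is_linear (fun x => scal k (f x)).
Proof.
  apply (is_linear_comp (fun x => f x) (fun y => scal k y)).
  - apply blin_linear.
  - apply is_linear_scal_r; apply Cmult_comm.
Qed.

Definition blin_plus (f g : blin U V) : blin U V := Blin _ (blin_plus_linear f g).
Definition blin_opp (f : blin U V) : blin U V := Blin _ (blin_opp_linear f).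
Definition blin_scal (k : C_AbsRing) (f : blin U V) : blin U V :=
  Blin _ (blin_scal_linear k f).
Definition blin_zero : blin U V := Blin (fun _ => zero) (is_linear_zero).

Definition blin_AbelianMonoid_mixin : AbelianMonoid.mixin_of (blin U V).
Proof.
  refine (AbelianMonoid.Mixin (blin U V) blin_plus blin_zero _ _ _);
    intros; apply blin_eq; intro; simpl.
  - apply plus_comm.
  - apply plus_assoc.
  - apply plus_zero_r.
Defined.
Canonical blin_AbelianMonoid :=
  AbelianMonoid.Pack (blin U V) blin_AbelianMonoid_mixin (blin U V).

Definition blin_AbelianGroup_mixin : AbelianGroup.mixin_of blin_AbelianMonoid.
Proof.
  refine (AbelianGroup.Mixin blin_AbelianMonoid blin_opp _).
  intros f; apply blin_eq; intros x; simpl; exact (plus_opp_r (f x)).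
Defined.
Canonical blin_AbelianGroup :=
  AbelianGroup.Pack (blin U V)
    (AbelianGroup.Class _ _ blin_AbelianGroup_mixin) (blin U V).

Definition blin_ModuleSpace_mixin :
  ModuleSpace.mixin_of C_Ring blin_AbelianGroup.
Proof.
  refine (ModuleSpace.Mixin C_Ring blin_AbelianGroup blin_scal _ _ _ _);
    intros; apply blin_eq; intro; simpl.
  - exact (scal_assoc x y _).
  - exact (scal_one (K := C_Ring) _).
  - exact (scal_distr_l x _ _).
  - exact (scal_distr_r x y _).
Defined.
Canonical blin_ModuleSpace :=
  ModuleSpace.Pack C_Ring (blin U V)
    (ModuleSpace.Class C_Ring _ _ blin_ModuleSpace_mixin) (blin U V).

Definition opnorm (f : blin U V) : R :=
  real (Lub_Rbar (fun r => exists x : U, norm x <= 1 /\ r = norm (f x))).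

Lemma opnorm_lub (f : blin U V) :
  is_lub_Rbar (fun r => exists x : U, norm x <= 1 /\ r = norm (f x))
    (Finite (opnorm f)).
Proof.
  unfold opnorm.
  destruct (Lub_Rbar_correct
    (fun r => exists x : U, norm x <= 1 /\ r = norm (f x))) as [H1 H2].
  destruct (linear_norm _ (blin_linear f)) as [M [HM Hf]].
  assert (Hub : Rbar_le
    (Lub_Rbar (fun r => exists x : U, norm x <= 1 /\ r = norm (f x))) M).
  { apply H2; intros r [x [Hx ->]]; simpl.
    eapply Rle_trans; [apply Hf|].
    rewrite <- (Rmult_1_r M) at 2.
    apply Rmult_le_compat_l; lra. }
  assert (H0 : Rbar_le (norm (f zero))
    (Lub_Rbar (fun r => exists x : U, norm x <= 1 /\ r = norm (f x)))).
  { apply H1; exists zero; split; [rewrite norm_zero; lra | reflexivity]. }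
  destruct (Lub_Rbar (fun r => exists x : U, norm x <= 1 /\ r = norm (f x)))
    as [l| |]; simpl in *; try contradiction.
  split; [exact H1 | exact H2].
Qed.

Lemma opnorm_ub (f : blin U V) (x : U) : norm x <= 1 -> norm (f x) <= opnorm f.
Proof.
  intros Hx; destruct (opnorm_lub f) as [H _].
  apply (H (norm (f x))); now exists x.
Qed.

Lemma opnorm_le (f : blin U V) (M : R) :
  (forall x : U, norm x <= 1 -> norm (f x) <= M) -> opnorm f <= M.
Proof.
  intros HM; destruct (opnorm_lub f) as [_ H].
  apply (H (Finite M)); intros r [x [Hx ->]]; simpl; now apply HM.
Qed.

Lemma opnorm_ge_0 (f : blin U V) : 0 <= opnorm f.
Proof.
  apply Rle_trans with (norm (f zero)); [apply norm_ge_0|].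
  apply opnorm_ub; rewrite norm_zero; lra.
Qed.

Lemma opnorm_triangle (f g : blin U V) :
  opnorm (plus f g) <= opnorm f + opnorm g.
Proof.
  apply opnorm_le; intros x Hx; simpl.
  eapply Rle_trans; [apply norm_triangle|].
  apply Rplus_le_compat; now apply opnorm_ub.
Qed.

Lemma opnorm_scal (k : C_AbsRing) (f : blin U V) :
  opnorm (scal k f) <= abs k * opnorm f.
Proof.
  apply opnorm_le; intros x Hx; simpl.
  eapply Rle_trans; [apply norm_scal|].
  apply Rmult_le_compat_l; [apply abs_ge_0 | now apply opnorm_ub].
Qed.

Lemma opnorm_opp (f : blin U V) : opnorm (opp f) = opnorm f.
Proof.
  apply Rle_antisym; apply opnorm_le; intros x Hx.
  - simpl; rewrite norm_opp; now apply opnorm_ub.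
  - replace (norm (f x)) with (norm (opp f x)) by (simpl; apply norm_opp).
    now apply opnorm_ub.
Qed.

Lemma opnorm_eq_0 (f : blin U V) : opnorm f = 0 -> f = zero.
Proof.
  intros H; apply blin_eq; intros x; simpl.
  apply norm_eq_zero; apply Rle_antisym; [|apply norm_ge_0].
  set (c := / (1 + norm x)).
  assert (Hn := norm_ge_0 x).
  assert (Hc : 0 < c) by (apply Rinv_0_lt_compat; lra).
  assert (Hcx : norm (scal (RtoC c : C_AbsRing) x) <= 1).
  { eapply Rle_trans; [apply norm_scal|].
    change (Cmod (RtoC c) * norm x <= 1).
    rewrite Cmod_R, Rabs_pos_eq by lra.
    unfold c; apply Rmult_le_reg_l with (1 + norm x); [lra|].
    rewrite <- Rmult_assoc, Rinv_r by lra; lra. }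
  assert (E : f x = scal (RtoC (/ c) : C_AbsRing) (f (scal (RtoC c : C_AbsRing) x))).
  { rewrite (linear_scal _ (blin_linear f)), scal_assoc.
    change (mult (RtoC (/ c) : C_AbsRing) (RtoC c)) with (Cmult (RtoC (/ c)) (RtoC c)).
    rewrite <- RtoC_mult, Rinv_l by lra.
    symmetry; exact (scal_one (K := C_Ring) _). }
  rewrite E.
  eapply Rle_trans; [apply norm_scal|].
  apply opnorm_ub with (f := f) in Hcx; rewrite H in Hcx.
  assert (Ha := abs_ge_0 (RtoC (/ c) : C_AbsRing)).
  assert (Hb := norm_ge_0 (f (scal (RtoC c : C_AbsRing) x))).
  replace (norm (f (scal (RtoC c : C_AbsRing) x))) with 0 by lra; lra.
Qed.

Definition blin_ball (f : blin U V) (e : R) (g : blin U V) : Prop :=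
  opnorm (minus g f) < e.

Definition blin_UniformSpace_mixin : UniformSpace.mixin_of (blin U V).
Proof.
  refine (UniformSpace.Mixin (blin U V) zero blin_ball _ _ _); unfold blin_ball.
  - intros f e; rewrite minus_eq_zero.
    apply Rle_lt_trans with 0; [|apply cond_pos].
    apply opnorm_le; intros x _; simpl; rewrite norm_zero; lra.
  - intros f g e H.
    rewrite <- (opp_minus g f), opnorm_opp; exact H.
  - intros f g h e1 e2 H1 H2.
    rewrite (minus_trans g).
    eapply Rle_lt_trans; [apply opnorm_triangle|].
    rewrite Rplus_comm; now apply Rplus_lt_compat.
Defined.
Canonical blin_UniformSpace :=
  UniformSpace.Pack (blin U V) blin_UniformSpace_mixin (blin U V).

Canonical blin_NormedModuleAux :=
  NormedModuleAux.Pack C_AbsRing (blin U V)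
    (NormedModuleAux.Class C_AbsRing _ (ModuleSpace.class C_Ring blin_ModuleSpace)
       blin_UniformSpace_mixin) (blin U V).

Definition blin_NormedModule_mixin :
  NormedModule.mixin_of C_AbsRing blin_NormedModuleAux.
Proof.
  refine (NormedModule.Mixin C_AbsRing blin_NormedModuleAux opnorm 1 _ _ _ _ _).
  - exact opnorm_triangle.
  - exact opnorm_scal.
  - intros f g e H; exact H.
  - intros f g e H; rewrite Rmult_1_l; exact H.
  - exact opnorm_eq_0.
Defined.
Canonical blin_NormedModule :=
  NormedModule.Pack C_AbsRing (blin U V)
    (NormedModule.Class C_AbsRing _ _ blin_NormedModule_mixin) (blin U V).

End BlinModule.

Definition blin_comp {U V W : CNormed} (g : blin V W) (f : blin U V) : blin U W :=
  Blin (fun x => g (f x))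
    (is_linear_comp (fun x => f x) (fun y => g y) (blin_linear f) (blin_linear g)).

Definition dual (X : CNormed) : CNormed := @blin_NormedModule X C_NormedModule.

Definition badjoint {U V : CNormed} (L : blin U V) (phi : dual V) : dual U :=
  blin_comp phi L.

(* Same vectors, norm and topology.  Coquelicot's vector-valued Riemann integral
   is only defined for real normed modules. *)
Section RestrictScalars.
Variable X : CNormed.

Definition real_ModuleSpace_mixin :
  ModuleSpace.mixin_of R_Ring (NormedModule.AbelianGroup C_AbsRing X).
Proof.
  refine (ModuleSpace.Mixin R_Ring (NormedModule.AbelianGroup C_AbsRing X)
    (fun r x => scal (RtoC r : C_AbsRing) x) _ _ _ _).
  - intros r s x; rewrite scal_assoc; f_equal.
    symmetry; exact (RtoC_mult r s).
  - intros x; exact (scal_one (K := C_Ring) x).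
  - intros r x y; exact (scal_distr_l (V := NormedModule.ModuleSpace C_AbsRing X) (RtoC r : C_AbsRing) x y).
  - intros r s x.
    rewrite <- (scal_distr_r (V := NormedModule.ModuleSpace C_AbsRing X)
      (RtoC r : C_AbsRing) (RtoC s : C_AbsRing)); f_equal.
    exact (RtoC_plus r s).
Defined.

Definition real_NormedModuleAux : NormedModuleAux R_AbsRing :=
  NormedModuleAux.Pack R_AbsRing X
    (NormedModuleAux.Class R_AbsRing X
       (ModuleSpace.Class R_Ring X _ real_ModuleSpace_mixin)
       (UniformSpace.class (NormedModule.UniformSpace C_AbsRing X))) X.

Definition real_NormedModule_mixin :
  NormedModule.mixin_of R_AbsRing real_NormedModuleAux.
Proof.
  refine (NormedModule.Mixin R_AbsRing real_NormedModuleAux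
    (fun x : X => norm x) (@norm_factor C_AbsRing X) _ _ _ _ _).
  - exact (@norm_triangle C_AbsRing X).
  - intros r x.
    replace (abs r) with (abs (RtoC r : C_AbsRing)) by exact (Cmod_R r).
    exact (norm_scal (RtoC r : C_AbsRing) (x : X)).
  - exact (@norm_compat1 C_AbsRing X).
  - exact (@norm_compat2 C_AbsRing X).
  - exact (@norm_eq_zero C_AbsRing X).
Defined.

Definition real_NormedModule : NormedModule R_AbsRing :=
  NormedModule.Pack R_AbsRing X
    (NormedModule.Class R_AbsRing X _ real_NormedModule_mixin) X.

End RestrictScalars.

(* An unbounded operator is its graph: [S x y] means that x is in the domain of
   S and S x = y.  Linearity and single-valuedness are not part of the type; a
   generator has both by [is_generator]. *)
Definition operator (X : CNormed) : Type := X -> X -> Prop.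

Section Operators.
Context {X : CNormed}.

Definition dom (S : operator X) (x : X) : Prop := exists y, S x y.

Definition op_opp (S : operator X) : operator X := fun x y => S x (opp y).

(* lambda I + S *)
Definition op_shift (lambda : C) (S : operator X) : operator X :=
  fun x y => S x (minus y (scal (lambda : C_AbsRing) x)).

Definition op_inv (S : operator X) : operator X := fun x y => S y x.

Definition op_comp (S' S : operator X) : operator X :=
  fun x z => exists y, S x y /\ S' y z.

Fixpoint op_pow (S : operator X) (n : nat) : operator X :=
  match n with
  | O => fun x y => x = y
  | Datatypes.S m => op_comp S (op_pow S m)
  end.

(* Includes that S : D(S) -> X is bijective. *)
Definition is_bounded_inverse (S : operator X) (L : blin X X) : Prop :=
  forall x y : X, S x y <-> L y = x.

Definition resolvent_set (A : operator X) (lambda : C) : Prop :=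
  exists L : blin X X, is_bounded_inverse (op_shift lambda (op_opp A)) L.

(* The dual operator S*; a single-valued operator when D(S) is dense. *)
Definition adjoint (S : operator X) : operator (dual X) :=
  fun phi psi => forall x y : X, S x y -> bfun phi y = bfun psi x.

(* S^(-theta), 0 < theta < 1, by Balakrishnan's formula
     S^(-theta) x = sin(pi theta)/pi * int_0^oo s^(-theta) (s + S)^(-1) x ds,
   for S sectorial with 0 in its resolvent set. *)
Definition neg_frac_pow (S : operator X) (theta : R) : operator X :=
  fun x y => exists (Res : R -> blin X X) (w : X),
    (forall s, 0 < s -> is_bounded_inverse (op_shift (RtoC s) S) (Res s)) /\
    @is_RInt_gen (real_NormedModule X)
      (fun s => scal (Rpower s (- theta) : R_AbsRing)
                  (Res s x : real_NormedModule X))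
      (at_right 0) (Rbar_locally p_infty) w /\
    y = scal (RtoC (sin (PI * theta) / PI) : C_AbsRing) w.

(* S^b = S^theta S^n with n = floor b, theta = b - n and
   S^theta = (S^(-theta))^(-1), for b >= 0 and S sectorial with 0 in its
   resolvent set.  Density of D(S) is not needed, so this also applies to
   the duals of such operators.  The case theta = 0 is separate because the
   integral above then diverges. *)
Definition frac_pow (S : operator X) (b : R) : operator X :=
  let n := Z.to_nat (Int_part b) in
  let theta := frac_part b in
  fun x y =>
    (theta = 0 /\ op_pow S n x y) \/
    (0 < theta /\ op_comp (op_inv (neg_frac_pow S theta)) (op_pow S n) x y).

End Operators.

(* The operator matrix ((A1, P), (0, A2)) with domain D(A1) x D(A2). *)
Definition block_op {X1 X2 : CNormed} (A1 : operator X1) (P : blin X2 X1)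
    (A2 : operator X2) : operator (prod_NormedModule C_AbsRing X1 X2) :=
  fun x y => exists z : X1,
    A1 (fst x) z /\ fst y = plus z (P (snd x)) /\ A2 (snd x) (snd y).

Section Semigroups.
Context {X : CNormed}.

(* Only the values T t with t >= 0 matter. *)
Definition C0_semigroup (T : R -> blin X X) : Prop :=
  (forall x : X, T 0 x = x) /\
  (forall s t, 0 <= s -> 0 <= t -> forall x : X, T (s + t) x = T s (T t x)) /\
  (forall x : X, filterlim (fun t => T t x) (at_right 0) (locally x)).

Definition is_generator (A : operator X) (T : R -> blin X X) : Prop :=
  forall x y : X,
    A x y <->
    filterlim (fun h => scal (RtoC (/ h) : C_AbsRing) (minus (T h x) x))
      (at_right 0) (locally y).

Definition generates (A : operator X) (T : R -> blin X X) : Prop :=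
  C0_semigroup T /\ is_generator A T.

Definition polynomially_stable (A : operator X) (T : R -> blin X X)
    (alpha : R) : Prop :=
  (exists K, forall t, 0 <= t -> norm (T t) <= K) /\
  (forall w : R, resolvent_set A (0, w)) /\
  (exists Ainv : blin X X, is_bounded_inverse A Ainv /\
   exists M, 1 <= M /\
     forall t, 0 < t ->
       norm (blin_comp (T t) Ainv) <= M * Rpower t (- (1 / alpha))).

Definition strongly_stable (T : R -> blin X X) : Prop :=
  forall x : X, filterlim (fun t => T t x) (Rbar_locally p_infty) (locally (zero : X)).

End Semigroups.

(* Main.v *)
(** By uniqueness for the Cauchy problem, T(t) is upper triangular with diagonal T1(t), T2(t) and
    corner S(t) = int_0^t T1(t-s) B C T2(s) ds.  The range conditions, the moment inequality for
    fractional powers and the uniform boundedness principle give |T1(t) B| = O((1+t)^-a) and, by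
    duality and Hahn-Banach, |C T2(t)| = O((1+t)^-b) with a = beta/alpha1, b = gamma/alpha2.  As
    u^a v^b <= u^(a+b) + v^(a+b) and a + b > 1, S(t) is uniformly bounded.  The rate then follows
    without resolvent estimates: T(2s) A^-1 = T(s) A^-1 T(s), and each component of A^-1 T(s) z
    is either O(s^(-1/alpha2)) or in the range of A1^-1, so |T(t) A^-1| is in fact
    O(t^(-1/alpha1) + t^(-1/alpha2)).  Strong stability follows by density of the domain. *)
From mathcomp Require classical_sets.
Require Import Defs.
From Stdlib Require Import Reals Lra Lia ZArith List Classical ClassicalEpsilon.
From Coquelicot Require Import Coquelicot.
Open Scope R_scope.

(** * Vector identities *)

(** The corner of T(t) is never formed as a vector-valued integral. For z in D(A) the curve s ->
    T1(t-s) applied to the first component of T(s)z is differentiable from the right, and a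
    one-sided mean value inequality bounds its increment by that of a scalar primitive; density of
    D(A) reaches the remaining z. At that stage only local boundedness of T is available, because
    its uniform boundedness is the very thing being proved. The condition on C concerns the adjoint
    of A2, whose dual semigroup need not be strongly continuous. The decay argument therefore runs
    on the algebraic and norm properties collected in [decaying_semigroup], which -A1 and the
    adjoint of -A2 share. Among them, the a priori estimate s|u| <= K|z| for (s + S)u = z controls
    Balakrishnan's integrand. The range conditions speak of one orbit at a time; operator norm rates
    come from Banach-Steinhaus on Y and on its dual, and Hahn-Banach is the price for returning from
    the transpose. The rate obtained implies the stated one since each 1/alpha_i exceeds 1/(alpha1 +
    alpha2) and ln t >= 1 for t >= 3. *)

Section ComplexScalars.
Context {V : CNormed}.
Implicit Types (k l : C) (x y : V).

Lemma scalC_one x : scal (RtoC 1 : C_AbsRing) x = x.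
Proof. exact (scal_one (K := C_Ring) x). Qed.

Lemma scalC_assoc k l x :
  scal (k : C_AbsRing) (scal (l : C_AbsRing) x) = scal (Cmult k l : C_AbsRing) x.
Proof. exact (scal_assoc (k : C_AbsRing) (l : C_AbsRing) x). Qed.

Lemma scalC_plus_l k l x :
  scal (Cplus k l : C_AbsRing) x = plus (scal (k : C_AbsRing) x) (scal (l : C_AbsRing) x).
Proof. exact (scal_distr_r (V := NormedModule.ModuleSpace C_AbsRing V) (k : C_AbsRing) (l : C_AbsRing) x). Qed.

Lemma scalC_plus_r k x y :
  scal (k : C_AbsRing) (plus x y) = plus (scal (k : C_AbsRing) x) (scal (k : C_AbsRing) y).
Proof. exact (scal_distr_l (V := NormedModule.ModuleSpace C_AbsRing V) (k : C_AbsRing) x y). Qed.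

Lemma scalC_zero x : scal (RtoC 0 : C_AbsRing) x = zero.
Proof. exact (scal_zero_l (V := NormedModule.ModuleSpace C_AbsRing V) x). Qed.

Lemma scalC_zero_r k : scal (k : C_AbsRing) (zero : V) = zero.
Proof. exact (scal_zero_r (V := NormedModule.ModuleSpace C_AbsRing V) (k : C_AbsRing)). Qed.

Lemma scalC_opp_l k x : scal (Copp k : C_AbsRing) x = opp (scal (k : C_AbsRing) x).
Proof. exact (scal_opp_l (V := NormedModule.ModuleSpace C_AbsRing V) (k : C_AbsRing) x). Qed.

End ComplexScalars.

(* Coquelicot reaches the group operations of a normed module through several
   unification-opaque paths, which defeats rewriting.  The tactic [vmod] decides
   vector identities by reflection, comparing coefficients with [ring]. *)
Inductive vexpr : Type :=
  | VVar (n : nat) | VZero | VPlus (a b : vexpr) | VOpp (a : vexpr) | VScal (k : C) (a : vexpr).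

Section VectorIdentities.
Context {V : CNormed}.
Implicit Types (env : list V) (e : vexpr) (c : nat -> C).

Definition vplus (x y : V) : V := plus x y.
Definition vopp (x : V) : V := opp x.
Definition vscal (k : C) (x : V) : V := scal (k : C_AbsRing) x.
Definition vzero : V := zero.

Lemma vplus_comm x y : vplus x y = vplus y x.
Proof. exact (plus_comm (G := NormedModule.AbelianMonoid C_AbsRing V) x y). Qed.
Lemma vplus_assoc x y z : vplus x (vplus y z) = vplus (vplus x y) z.
Proof. exact (plus_assoc (G := NormedModule.AbelianMonoid C_AbsRing V) x y z). Qed.
Lemma vplus_zero x : vplus x vzero = x.
Proof. exact (plus_zero_r (G := NormedModule.AbelianMonoid C_AbsRing V) x). Qed.
Lemma vplus_zero_l x : vplus vzero x = x.
Proof. now rewrite vplus_comm, vplus_zero. Qed.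

Fixpoint veval env e : V :=
  match e with
  | VVar n => nth n env vzero
  | VZero => vzero
  | VPlus a b => vplus (veval env a) (veval env b)
  | VOpp a => vopp (veval env a)
  | VScal k a => vscal k (veval env a)
  end.

Fixpoint vcoef e (n : nat) : C :=
  match e with
  | VVar m => if Nat.eqb m n then 1 else 0
  | VZero => 0
  | VPlus a b => Cplus (vcoef a n) (vcoef b n)
  | VOpp a => Copp (vcoef a n)
  | VScal k a => Cmult k (vcoef a n)
  end.

Fixpoint vsum env c : V :=
  match env with
  | nil => vzero
  | cons v r => vplus (vscal (c O) v) (vsum r (fun n => c (S n)))
  end.

Lemma vsum_zero env : vsum env (fun _ => RtoC 0) = vzero.
Proof.
  induction env as [|v r IH]; simpl; trivial.
  rewrite IH, vplus_zero; apply scalC_zero.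
Qed.

Lemma vsum_plus env c c' : vsum env (fun n => Cplus (c n) (c' n)) = vplus (vsum env c) (vsum env c').
Proof.
  revert c c'; induction env as [|v r IH]; simpl; intros c c'.
  - symmetry; apply vplus_zero.
  - rewrite (IH (fun n => c (S n)) (fun n => c' (S n))).
    unfold vscal at 1; rewrite (scalC_plus_l (c O) (c' O) v).
    change (plus (scal (c O : C_AbsRing) v) (scal (c' O : C_AbsRing) v))
      with (vplus (vscal (c O) v) (vscal (c' O) v)).
    rewrite !vplus_assoc; f_equal; rewrite <- !vplus_assoc; f_equal; apply vplus_comm.
Qed.

Lemma vsum_scal env k c : vsum env (fun n => Cmult k (c n)) = vscal k (vsum env c).
Proof.
  revert c; induction env as [|v r IH]; simpl; intros c.
  - symmetry; apply scalC_zero_r.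
  - rewrite (IH (fun n => c (S n))).
    etransitivity; [|symmetry; apply scalC_plus_r].
    unfold vplus; f_equal; symmetry; apply scalC_assoc.
Qed.

Lemma veval_vsum env e : veval env e = vsum env (vcoef e).
Proof.
  induction e as [n| |a IHa b IHb|a IHa|k a IHa]; simpl.
  - revert n; induction env as [|v r IH]; intros [|n]; simpl; trivial.
    + rewrite vsum_zero, vplus_zero; symmetry; apply scalC_one.
    + rewrite IH; symmetry.
      transitivity (vplus vzero (vsum r (fun k => if Nat.eqb n k then RtoC 1 else RtoC 0))).
      * f_equal; apply scalC_zero.
      * apply vplus_zero_l.
  - symmetry; apply vsum_zero.
  - rewrite IHa, IHb; symmetry; apply vsum_plus.
  - rewrite IHa.
    transitivity (vscal (Copp 1) (vsum env (vcoef a))).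
    + unfold vscal; rewrite (scalC_opp_l 1 (vsum env (vcoef a))); unfold vopp; f_equal.
      symmetry; apply scalC_one.
    + rewrite <- vsum_scal; f_equal.
      apply FunctionalExtensionality.functional_extensionality; intros n; ring.
  - rewrite IHa; symmetry; apply vsum_scal.
Qed.

Fixpoint vsame (n : nat) c c' : Prop :=
  match n with
  | O => True
  | S m => c O = c' O /\ vsame m (fun i => c (S i)) (fun i => c' (S i))
  end.

(** Soundness of [vmod]. Only the indices below the length of [env] are compared: out-of-range
    variables evaluate to [vzero], so their coefficients have no effect. *)
Lemma veval_eq env e e' :
  vsame (length env) (vcoef e) (vcoef e') -> veval env e = veval env e'.
Proof.
  rewrite !veval_vsum; generalize (vcoef e) (vcoef e'); clear e e'.
  induction env as [|v r IH]; simpl; intros c c'; trivial.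
  intros [-> H]; f_equal; now apply IH.
Qed.

End VectorIdentities.

(* [constr_eq] keeps the comparison of atoms syntactic. *)
Ltac vmember x l :=
  lazymatch l with
  | nil => constr:(false)
  | cons ?h ?r =>
    match goal with
    | _ => let _ := match goal with _ => constr_eq x h end in constr:(true)
    | _ => vmember x r
    end
  end.
Ltac vindex x l :=
  lazymatch l with
  | cons ?h ?r =>
    match goal with
    | _ => let _ := match goal with _ => constr_eq x h end in constr:(O)
    | _ => let n := vindex x r in constr:(S n)
    end
  end.
Ltac vcollect e l :=
  lazymatch e with
  | plus ?a ?b => let l := vcollect a l in vcollect b l
  | minus ?a ?b => let l := vcollect a l in vcollect b l
  | opp ?a => vcollect a l
  | scal _ ?a => vcollect a l
  | zero => l
  | _ => lazymatch vmember e l with true => l | false => constr:(cons e l) end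
  end.
Ltac vreify e l :=
  lazymatch e with
  | plus ?a ?b => let a := vreify a l in let b := vreify b l in constr:(VPlus a b)
  | minus ?a ?b => let a := vreify a l in let b := vreify b l in constr:(VPlus a (VOpp b))
  | opp ?a => let a := vreify a l in constr:(VOpp a)
  | scal ?k ?a => let a := vreify a l in constr:(VScal k a)
  | zero => constr:(VZero)
  | _ => let n := vindex e l in constr:(VVar n)
  end.
Ltac vmod V :=
  lazymatch goal with
  | |- ?a = ?b =>
    let l := vcollect a (@nil (NormedModule.sort C_AbsRing V)) in
    let l := vcollect b l in
    let ea := vreify a l in let eb := vreify b l in
    change (@veval V l ea = @veval V l eb);
    apply veval_eq; cbn [vsame vcoef length Nat.eqb]; repeat split; try ring
  end.

(** * Norms and bounded operators *)

Lemma norm_eq {V : CNormed} (x y : V) : x = y -> norm x = norm y.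
Proof. now intros ->. Qed.

(** The structure supplies only one inequality; applying it to the inverse scalar reverses it. *)
Lemma norm_scalC {V : CNormed} (k : C) (x : V) :
  norm (scal (k : C_AbsRing) x) = Cmod k * norm x.
Proof.
  apply Rle_antisym; [exact (norm_scal (k : C_AbsRing) x)|].
  destruct (Ceq_dec k 0) as [->|Hk].
  { rewrite Cmod_0, Rmult_0_l; apply norm_ge_0. }
  assert (H := norm_scal (/ k : C_AbsRing)%C (scal (k : C_AbsRing) x)).
  rewrite scalC_assoc, (Cinv_l k Hk), scalC_one in H.
  change (norm x <= Cmod (/ k) * norm (scal (k : C_AbsRing) x)) in H.
  rewrite Cmod_inv in H by exact Hk.
  assert (Hp : 0 < Cmod k) by now apply Cmod_gt_0.
  apply Rmult_le_reg_l with (/ Cmod k); [now apply Rinv_0_lt_compat|].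
  rewrite <- Rmult_assoc, Rinv_l, Rmult_1_l by lra; exact H.
Qed.

Lemma norm_scalR {V : CNormed} (r : R) (x : V) :
  norm (scal (RtoC r : C_AbsRing) x) = Rabs r * norm x.
Proof. now rewrite norm_scalC, Cmod_R. Qed.

Lemma scalR_pos {V : CNormed} (r : R) (x : V) : 0 <= r ->
  norm (scal (RtoC r : C_AbsRing) x) = r * norm x.
Proof. intros H; now rewrite norm_scalR, Rabs_pos_eq. Qed.

Lemma norm_minus_self {V : CNormed} (x : V) : norm (minus x x) = 0.
Proof. rewrite minus_eq_zero; apply norm_zero. Qed.

Lemma norm_minus_sym {V : CNormed} (x y : V) : norm (minus x y) = norm (minus y x).
Proof. now rewrite <- opp_minus, norm_opp. Qed.

Lemma norm_minus_trans {V : CNormed} (y x z : V) :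
  norm (minus x z) <= norm (minus x y) + norm (minus y z).
Proof. rewrite (minus_trans y x z); apply norm_triangle. Qed.

Lemma norm_minus_le {V : CNormed} (x y : V) : norm (minus x y) <= norm x + norm y.
Proof. unfold minus; rewrite <- (norm_opp y); apply norm_triangle. Qed.

Lemma norm_le_minus {V : CNormed} (x y : V) : norm x <= norm (minus x y) + norm y.
Proof.
  replace x with (plus (minus x y) y) at 1; [apply norm_triangle|].
  vmod V.
Qed.

Lemma norm_minus_le_0 {V : CNormed} (x y : V) : norm (minus x y) <= 0 -> x = y.
Proof.
  intros H.
  assert (E : minus x y = zero) by (apply norm_eq_zero, Rle_antisym; [exact H | apply norm_ge_0]).
  transitivity (plus (minus x y) y); [vmod V|].
  transitivity (plus zero y); [f_equal; exact E | vmod V].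
Qed.

Section Blin.
Context {U V : CNormed}.
Implicit Type f : blin U V.

Lemma bplus f x y : f (plus x y) = plus (f x) (f y).
Proof. apply linear_plus, blin_linear. Qed.

Lemma bscal f (k : C_AbsRing) x : f (scal k x) = scal k (f x).
Proof. apply linear_scal, blin_linear. Qed.

Lemma bzero f : f zero = zero.
Proof.
  transitivity (f (scal (RtoC 0 : C_AbsRing) zero)).
  - f_equal; symmetry; apply scalC_zero.
  - rewrite bscal; apply scalC_zero.
Qed.

Lemma bopp f x : f (opp x) = opp (f x).
Proof.
  transitivity (f (scal (Copp 1 : C_AbsRing) x)).
  - f_equal; symmetry; exact (eq_trans (scalC_opp_l 1 x) (f_equal opp (scalC_one x))).
  - rewrite bscal; exact (eq_trans (scalC_opp_l 1 (f x)) (f_equal opp (scalC_one (f x)))).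
Qed.

Lemma bminus f x y : f (minus x y) = minus (f x) (f y).
Proof. unfold minus; now rewrite bplus, bopp. Qed.

Lemma blin_bound f x : norm (f x) <= opnorm f * norm x.
Proof.
  destruct (Req_dec (norm x) 0) as [H|H].
  { rewrite (norm_eq_zero _ H), bzero, !norm_zero; lra. }
  assert (Hx := norm_ge_0 x).
  assert (Hi : 0 < / norm x) by (apply Rinv_0_lt_compat; lra).
  assert (E := opnorm_ub f (scal (RtoC (/ norm x) : C_AbsRing) x)).
  rewrite bscal, !scalR_pos in E by lra.
  rewrite Rinv_l in E by lra.
  apply Rmult_le_reg_l with (/ norm x); trivial.
  rewrite (Rmult_comm (opnorm f)), <- Rmult_assoc, Rinv_l, Rmult_1_l by lra.
  apply E; lra.
Qed.

Lemma opnorm_le_bound f M : 0 <= M -> (forall x, norm (f x) <= M * norm x) -> opnorm f <= M.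
Proof.
  intros HM H; apply opnorm_le; intros x Hx.
  eapply Rle_trans; [apply H|].
  rewrite <- (Rmult_1_r M) at 2; now apply Rmult_le_compat_l.
Qed.

Lemma blin_bound_le f x M : opnorm f <= M -> norm (f x) <= M * norm x.
Proof.
  intros H; eapply Rle_trans; [apply blin_bound|].
  apply Rmult_le_compat_r; [apply norm_ge_0 | trivial].
Qed.
End Blin.

Lemma filterlim_norm_minus {T : Type} {V : CNormed} (F : (T -> Prop) -> Prop) {FF : Filter F}
    (f : T -> V) (y : V) :
  filterlim f F (locally y) <->
  (forall e, 0 < e -> F (fun t => norm (minus (f t) y) < e)).
Proof.
  rewrite (filterlim_locally_ball_norm f y); split.
  - intros H e He; exact (H (mkposreal e He)).
  - intros H e; exact (H e (cond_pos e)).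
Qed.

Lemma at_right0_iff (P : R -> Prop) :
  at_right 0 P <-> exists d, 0 < d /\ forall h, 0 < h < d -> P h.
Proof.
  unfold at_right, within; split.
  - intros [d Hd]; exists d; split; [apply cond_pos|].
    intros h Hh; apply Hd; [|lra].
    change (Rabs (h - 0) < d); rewrite Rabs_pos_eq; lra.
  - intros [d [Hd H]]; exists (mkposreal d Hd); intros h Hh Hp.
    change (Rabs (h - 0) < d) in Hh; apply H; rewrite Rabs_pos_eq in Hh; lra.
Qed.

Lemma filterlim_right0 {V : CNormed} (f : R -> V) (y : V) :
  filterlim f (at_right 0) (locally y) <->
  (forall e, 0 < e -> exists d, 0 < d /\ forall h, 0 < h < d -> norm (minus (f h) y) < e).
Proof.
  rewrite (filterlim_norm_minus (at_right 0)).
  split; intros H e He; apply at_right0_iff; auto.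
Qed.

(** * Mean value inequality *)

(** Tailored to semigroup orbits: a generator gives a derivative from the right only, and left
    continuity replaces the missing side. It takes the place of integrating the derivative of
    [F]. *)
Lemma mean_value_right {V : CNormed} (F : R -> V) (g : R -> R) (t : R) : 0 <= t ->
  (forall s, 0 < s <= t -> forall e, 0 < e ->
     exists d, 0 < d /\ forall r, 0 <= r -> s - d < r < s -> norm (minus (F s) (F r)) <= e) ->
  (forall s, 0 <= s <= t -> continuous g s) ->
  (forall s, 0 <= s < t -> forall e, 0 < e ->
     exists d, 0 < d /\ forall h, 0 < h < d -> s + h <= t ->
       norm (minus (F (s + h)) (F s)) <= g (s + h) - g s + e * h) ->
  norm (minus (F t) (F 0)) <= g t - g 0.
Proof.
  intros Ht HF Hg HD.
  assert (Hgc : forall s, 0 <= s <= t -> forall e, 0 < e ->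
     exists d, 0 < d /\ forall r, s - d < r < s -> g r <= g s + e).
  { intros s Hs e He.
    destruct (proj1 (filterlim_locally g (g s)) (Hg s Hs) (mkposreal e He)) as [d Hd].
    exists d; split; [apply cond_pos|]; intros r Hr.
    assert (H : Rabs (g r - g s) < e).
    { apply Hd; change (Rabs (r - s) < d); apply Rabs_def1; lra. }
    apply Rabs_def2 in H; lra. }
  apply le_epsilon; intros e1 He1.
  (* The slack is spread over the interval as a slope; t + 1 instead of t admits t = 0. *)
  set (e := e1 / (t + 1)).
  assert (He : 0 < e) by (apply Rdiv_lt_0_compat; lra).
  assert (Ee : e * t <= e1).
  { replace e1 with (e * (t + 1)) by (unfold e; field; lra); nra. }
  set (Q r := norm (minus (F r) (F 0)) <= g r - g 0 + e * r).
  (* Requiring [Q] on all of [0, s] makes [E] an initial segment, so [Q] holds at every point to the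
     left of its supremum. *)
  set (E s := 0 <= s <= t /\ forall r, 0 <= r <= s -> Q r).
  assert (E0 : E 0).
  { split; [lra|]; intros r Hr; replace r with 0 by lra.
    unfold Q; rewrite norm_minus_self; lra. }
  destruct (completeness E) as [m [Hm1 Hm2]].
  { exists t; intros s [Hs _]; lra. }
  { now exists 0. }
  assert (Hm0 : 0 <= m) by now apply Hm1.
  assert (Hmt : m <= t) by (apply Hm2; intros s [Hs _]; lra).
  assert (Hlt : forall r, 0 <= r < m -> Q r).
  { intros r Hr; destruct (classic (Q r)) as [|Hn]; trivial; exfalso.
    assert (m <= r); [|lra].
    apply Hm2; intros s [Hs1 Hs2].
    destruct (Rle_lt_dec s r); trivial; exfalso; apply Hn, Hs2; lra. }
  (* The supremum is attained: left continuity of [F] and continuity of [g] carry [Q] from a nearby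
     r' < m to m. *)
  assert (HEm : E m).
  { split; [lra|]; intros r Hr.
    destruct (Rle_lt_or_eq_dec r m (proj2 Hr)) as [|Hrm]; [apply Hlt; lra|].
    subst r.
    destruct (Rle_lt_or_eq_dec 0 m Hm0) as [Hp|Hz].
    2:{ rewrite <- Hz; apply E0; lra. }
    unfold Q; apply le_epsilon; intros e' He'.
    destruct (HF m (conj Hp Hmt) (e' / 2)) as [d1 [Hd1 H1]]; [lra|].
    destruct (Hgc m (conj Hm0 Hmt) (e' / 2)) as [d2 [Hd2 H2]]; [lra|].
    set (r' := Rmax (m / 2) (m - Rmin d1 d2 / 2)).
    assert (Hr' : m - Rmin d1 d2 < r' < m /\ 0 <= r').
    { assert (0 < Rmin d1 d2) by now apply Rmin_glb_lt.
      unfold r'; repeat split.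
      - apply Rlt_le_trans with (m - Rmin d1 d2 / 2); [lra | apply Rmax_r].
      - apply Rmax_lub_lt; lra.
      - apply Rle_trans with (m / 2); [lra | apply Rmax_l]. }
    assert (HL := Rmin_l d1 d2); assert (HR := Rmin_r d1 d2).
    assert (A1 := H1 r' (proj2 Hr') ltac:(lra)).
    assert (A2 := H2 r' ltac:(lra)).
    assert (A3 : Q r') by (apply Hlt; lra); unfold Q in A3.
    assert (A4 := norm_minus_trans (F r') (F m) (F 0)).
    assert (e * r' <= e * m) by (apply Rmult_le_compat_l; lra); lra. }
  destruct (Rle_lt_or_eq_dec m t Hmt) as [Hlt'|Heq].
  2:{ subst m; assert (A := proj2 HEm t ltac:(lra)); unfold Q in A; lra. }
  exfalso.
  (* If m < t, the estimate to the right of m pushes [E] beyond its supremum. *)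
  destruct (HD m (conj Hm0 Hlt') e He) as [d [Hd H]].
  set (m' := m + Rmin (d / 2) (t - m)).
  assert (Hmin : 0 < Rmin (d / 2) (t - m)) by (apply Rmin_glb_lt; lra).
  assert (HL := Rmin_l (d / 2) (t - m)); assert (HR := Rmin_r (d / 2) (t - m)).
  assert (E m'); [|assert (m' <= m) by (now apply Hm1); unfold m' in *; lra].
  split; [unfold m'; lra|]; intros r Hr.
  destruct (Rle_lt_dec r m) as [Hrm|Hrm]; [apply HEm; lra|].
  assert (A1 := H (r - m) ltac:(unfold m' in *; lra) ltac:(unfold m' in *; lra)).
  replace (m + (r - m)) with r in A1 by ring.
  assert (A2 := proj2 HEm m ltac:(lra)); unfold Q in *.
  assert (A3 := norm_minus_trans (F m) (F r) (F 0)); lra.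
Qed.

(** * Uniform boundedness and completeness *)

Definition cauchy_seq {U : CNormed} (u : nat -> U) : Prop :=
  forall e, 0 < e -> exists N, forall n m, (N <= n)%nat -> (N <= m)%nat ->
    norm (minus (u n) (u m)) < e.

Definition seq_lim {U : CNormed} (u : nat -> U) (l : U) : Prop :=
  forall e, 0 < e -> exists N, forall n, (N <= n)%nat -> norm (minus (u n) l) < e.

(** Completeness in this form passes easily to products and to duals, and Banach-Steinhaus is used
    on Y, on the dual of Y and on the product of X1 and X2. *)
Definition seq_complete (U : CNormed) : Prop :=
  forall u : nat -> U, cauchy_seq u -> exists l, seq_lim u l.

Lemma seq_lim_norm_le {U : CNormed} (u : nat -> U) (l x : U) (M : R) (N : nat) :
  seq_lim u l -> (forall n, (N <= n)%nat -> norm (minus (u n) x) <= M) ->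
  norm (minus l x) <= M.
Proof.
  intros Hl H; apply le_epsilon; intros e He.
  destruct (Hl e He) as [N' HN].
  assert (A := HN (max N N') ltac:(lia)); assert (B := H (max N N') ltac:(lia)).
  rewrite norm_minus_sym in A.
  assert (C := norm_minus_trans (u (max N N')) l x); lra.
Qed.

Section UniformBoundedness.
Context {U V : CNormed}.

(** For w of norm at most r, one of x + w and x - w has an image at least as large as f w. The
    factor 3/4 is there because the operator norm need not be attained. *)
Lemma large_value_nearby (f : blin U V) (x : U) (r : R) : 0 <= r ->
  exists x', norm (minus x' x) <= r /\ 3 / 4 * r * opnorm f <= norm (f x').
Proof.
  intros Hr.
  assert (Hu : exists u, norm u <= 1 /\ 3 / 4 * opnorm f <= norm (f u)).
  { apply NNPP; intros Hn.
    assert (H0 := opnorm_ge_0 f).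
    assert (opnorm f <= 3 / 4 * opnorm f).
    { apply opnorm_le; intros x' Hx'; apply Rnot_lt_le; intros Hlt.
      apply Hn; exists x'; split; lra. }
    apply Hn; exists zero; rewrite norm_zero; split; [lra|].
    assert (A := norm_ge_0 (f zero)); lra. }
  destruct Hu as [u [Hu1 Hu2]].
  set (w := scal (RtoC r : C_AbsRing) u).
  assert (Hw : norm w <= r) by (unfold w; rewrite scalR_pos by lra; nra).
  assert (Hfw : 3 / 4 * r * opnorm f <= norm (f w)).
  { unfold w; rewrite bscal, scalR_pos by lra; nra. }
  assert (E1 : minus (plus x w) x = w) by vmod U.
  assert (E2 : norm (minus (minus x w) x) = norm w).
  { rewrite <- (norm_opp w); f_equal; vmod U. }
  destruct (Rle_lt_dec (3 / 4 * r * opnorm f) (norm (f (plus x w)))) as [H|H].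
  { exists (plus x w); rewrite E1; split; trivial. }
  exists (minus x w); rewrite E2; split; trivial.
  (* 2 f w = f (x + w) - f (x - w) *)
  assert (E : scal (RtoC 2 : C_AbsRing) (f w) = minus (f (plus x w)) (f (minus x w))).
  { rewrite <- bminus, <- bscal; f_equal.
    replace (RtoC 2) with (Cplus 1 1) by (rewrite <- RtoC_plus; f_equal; ring).
    vmod U. }
  assert (E' : 2 * norm (f w) <= norm (f (plus x w)) + norm (f (minus x w))).
  { rewrite <- scalR_pos, E by lra; apply norm_minus_le. }
  lra.
Qed.

(* Sokal's gliding hump argument: each point of a rapidly converging sequence makes
   the next operator large, and the limit is too close to lose this. *)
Lemma uniform_boundedness (hU : seq_complete U) (L : blin U V -> Prop) :
  (forall x, exists M, forall f, L f -> norm (f x) <= M) ->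
  exists M, 0 <= M /\ forall f, L f -> opnorm f <= M.
Proof.
  intros Hpt; apply NNPP; intros Hn.
  (* The factor 4^n compensates the radius (1/4)^n of the n-th step, which leaves growth of order
     n. *)
  assert (Hbig : forall n : nat, exists f, L f /\ INR n * 4 ^ n <= opnorm f).
  { intros n; apply NNPP; intros Hn'; apply Hn; exists (INR n * 4 ^ n); split.
    - apply Rmult_le_pos; [apply pos_INR | apply pow_le; lra].
    - intros f Hf; apply Rnot_lt_le; intros Hlt; apply Hn'; exists f; split; [trivial | lra]. }
  apply choice in Hbig; destruct Hbig as [f Hf].
  set (r n := (1 / 4) ^ n).
  assert (Hr : forall n, 0 < r n) by (intros n; apply pow_lt; lra).
  assert (Hstep : forall p : nat * U, exists x', norm (minus x' (snd p)) <= r (fst p) /\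
      3 / 4 * r (fst p) * opnorm (f (fst p)) <= norm (f (fst p) x')).
  { intros [n x]; apply large_value_nearby, Rlt_le, Hr. }
  apply choice in Hstep; destruct Hstep as [step Hstep].
  set (u := fix u n := match n with O => zero | S k => step (k, u k) end : U).
  assert (H1 : forall n, norm (minus (u (S n)) (u n)) <= r n) by (intros n; apply (Hstep (n, u n))).
  assert (H2 : forall n, 3 / 4 * r n * opnorm (f n) <= norm (f n (u (S n))))
    by (intros n; apply (Hstep (n, u n))).
  (* Telescoped geometric series: consecutive radii differ by 3/4 of the larger one, hence the
     factor 4/3. *)
  assert (Htail : forall n k, norm (minus (u (n + k)%nat) (u n)) <= 4 / 3 * (r n - r (n + k)%nat)).
  { intros n k; induction k as [|k IH].
    - rewrite Nat.add_0_r, norm_minus_self; lra.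
    - rewrite Nat.add_succ_r.
      assert (A := norm_minus_trans (u (n + k)%nat) (u (S (n + k))) (u n)).
      assert (B := H1 (n + k)%nat).
      assert (r (S (n + k)) = r (n + k)%nat / 4) by (unfold r; simpl; lra); lra. }
  assert (Htail' : forall n m, (n <= m)%nat -> norm (minus (u m) (u n)) <= 4 / 3 * r n).
  { intros n m Hnm; replace m with (n + (m - n))%nat by lia.
    assert (A := Htail n (m - n)%nat); assert (B := Hr (n + (m - n))%nat); lra. }
  destruct (hU u) as [x Hx].
  { intros e He.
    destruct (pow_lt_1_zero (1 / 4) ltac:(rewrite Rabs_pos_eq; lra) (e / 4) ltac:(lra)) as [N HN].
    exists N; intros n m Hn' Hm.
    assert (A := Htail' N n Hn'); assert (B := Htail' N m Hm).
    assert (D := HN N (le_n N)); fold (r N) in D; rewrite Rabs_pos_eq in D by (apply Rlt_le, Hr).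
    assert (E := norm_minus_trans (u N) (u n) (u m)); rewrite (norm_minus_sym (u N)) in E; lra. }
  destruct (Hpt x) as [M HM].
  (* 5/12 = 3/4 - 1/3: the step secures 3/4 of [r n * opnorm (f n)], and the limit lies within 4/3
     of [r (S n)], that is [r n / 3], of [u (S n)]. *)
  destruct (INR_archimed (5 / 12) M ltac:(lra)) as [n Hn'].
  assert (A := HM (f n) (proj1 (Hf n))).
  assert (B : norm (minus x (u (S n))) <= 4 / 3 * r (S n)).
  { apply (seq_lim_norm_le u x _ _ (S n) Hx); intros m Hm; now apply Htail'. }
  replace (r (S n)) with (r n / 4) in B by (unfold r; simpl; lra).
  assert (D := norm_le_minus (f n (u (S n))) (f n x)).
  rewrite <- bminus in D; assert (E := blin_bound (f n) (minus (u (S n)) x)).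
  rewrite norm_minus_sym in E.
  assert (F := opnorm_ge_0 (f n)); assert (G := H2 n); assert (K := Hr n).
  assert (opnorm (f n) * norm (minus x (u (S n))) <= opnorm (f n) * (r n / 3))
    by (apply Rmult_le_compat_l; lra).
  assert (Q : INR n * 5 / 12 <= 5 / 12 * r n * opnorm (f n)).
  { assert (Z : r n * (INR n * 4 ^ n) = INR n).
    { unfold r; rewrite (Rmult_comm (INR n)), <- Rmult_assoc, <- Rpow_mult_distr.
      replace (1 / 4 * 4) with 1 by field; rewrite pow1; ring. }
    assert (r n * (INR n * 4 ^ n) <= r n * opnorm (f n)) by (apply Rmult_le_compat_l; [lra | apply Hf]).
    lra. }
  lra.
Qed.

End UniformBoundedness.

Lemma seq_complete_CompleteNormedModule (X : CompleteNormedModule C_AbsRing) :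
  seq_complete X.
Proof.
  intros u Hu.
  set (F := filtermap u eventually).
  assert (FF : ProperFilter F) by (apply filtermap_proper_filter, eventually_filter).
  assert (HF : cauchy F).
  { intros eps; destruct (Hu eps (cond_pos eps)) as [N HN].
    exists (u N), N; intros n Hn.
    apply (norm_compat1 (u N : NormedModuleAux.UniformSpace C_AbsRing X)).
    apply (HN n N Hn (le_n N)). }
  exists (lim F); intros e He.
  assert (Hf := @norm_factor_gt_0 C_AbsRing X).
  (* A ball of the uniform structure bounds the norm only up to the factor [norm_factor]. *)
  set (e' := mkposreal (e / @norm_factor C_AbsRing X) (Rdiv_lt_0_compat _ _ He Hf)).
  destruct (complete_cauchy F FF HF e') as [N HN].
  exists N; intros n Hn.
  assert (A := norm_compat2 _ _ _ (HN n Hn)).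
  replace e with (@norm_factor C_AbsRing X * e'); [exact A|].
  simpl; field; apply Rgt_not_eq, Hf.
Qed.

Lemma sqrt2_le_2 : sqrt 2 <= 2.
Proof. rewrite <- (sqrt_Rsqr 2) at 2 by lra; apply sqrt_le_1_alt; unfold Rsqr; lra. Qed.

Lemma seq_complete_C : seq_complete C_NormedModule.
Proof.
  intros u Hu.
  assert (Hre : forall n m, Rabs (fst (u n) - fst (u m)) <= norm (minus (u n) (u m))).
  { intros n m; apply (Rle_trans _ _ _ (Rmax_l _ _) (Rmax_Cmod (minus (u n) (u m)))). }
  assert (Him : forall n m, Rabs (snd (u n) - snd (u m)) <= norm (minus (u n) (u m))).
  { intros n m; apply (Rle_trans _ _ _ (Rmax_r _ _) (Rmax_Cmod (minus (u n) (u m)))). }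
  destruct (Rcomplete.R_complete (fun n => fst (u n))) as [a Ha].
  { intros e He; destruct (Hu e He) as [N HN]; exists N; intros n m Hn Hm.
    apply Rle_lt_trans with (1 := Hre n m); now apply HN. }
  destruct (Rcomplete.R_complete (fun n => snd (u n))) as [b Hb].
  { intros e He; destruct (Hu e He) as [N HN]; exists N; intros n m Hn Hm.
    apply Rle_lt_trans with (1 := Him n m); now apply HN. }
  exists ((a, b) : C); intros e He.
  destruct (Ha (e / 2) ltac:(lra)) as [N1 H1]; destruct (Hb (e / 2) ltac:(lra)) as [N2 H2].
  exists (max N1 N2); intros n Hn.
  specialize (H1 n ltac:(lia)); specialize (H2 n ltac:(lia)); unfold Rdist in H1, H2.
  assert (A := Cmod_2Rmax (minus (u n) ((a, b) : C))).
  change (Cmod (minus (u n) ((a, b) : C)) < e).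
  assert (B : Rmax (Rabs (fst (minus (u n) ((a, b) : C)))) (Rabs (snd (minus (u n) ((a, b) : C)))) < e / 2).
  { apply Rmax_lub_lt; assumption. }
  assert (Hsqrt := sqrt2_le_2).
  assert (S2 := sqrt_pos 2).
  assert (D := Rle_trans _ _ _ (Rabs_pos _) (Rmax_l (Rabs (fst (minus (u n) ((a, b) : C)))) (Rabs (snd (minus (u n) ((a, b) : C)))))).
  nra.
Qed.

Lemma seq_complete_prod (U V : CNormed) : seq_complete U -> seq_complete V ->
  seq_complete (prod_NormedModule C_AbsRing U V).
Proof.
  intros hU hV u Hu.
  destruct (hU (fun n => fst (u n))) as [a Ha].
  { intros e He; destruct (Hu e He) as [N HN]; exists N; intros n m Hn Hm.
    eapply Rle_lt_trans; [|exact (HN n m Hn Hm)].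
    exact (norm_le_prod_norm_1 (minus (u n) (u m))). }
  destruct (hV (fun n => snd (u n))) as [b Hb].
  { intros e He; destruct (Hu e He) as [N HN]; exists N; intros n m Hn Hm.
    eapply Rle_lt_trans; [|exact (HN n m Hn Hm)].
    exact (norm_le_prod_norm_2 (minus (u n) (u m))). }
  exists (a, b); intros e He.
  destruct (Ha (e / 2) ltac:(lra)) as [N1 H1]; destruct (Hb (e / 2) ltac:(lra)) as [N2 H2].
  exists (max N1 N2); intros n Hn.
  specialize (H1 n ltac:(lia)); specialize (H2 n ltac:(lia)).
  assert (A := proj2 (norm_prod (minus (fst (u n)) a) (minus (snd (u n)) b))).
  assert (B := Rmax_lub_lt _ _ _ H1 H2).
  assert (Hsqrt := sqrt2_le_2).
  assert (S2 := sqrt_pos 2).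
  assert (D := Rle_trans _ _ _ (norm_ge_0 _) (Rmax_l (norm (minus (fst (u n)) a)) (norm (minus (snd (u n)) b)))).
  apply Rle_lt_trans with (1 := A); nra.
Qed.

Lemma seq_lim_plus {V : CNormed} (u v : nat -> V) (a b : V) :
  seq_lim u a -> seq_lim v b -> seq_lim (fun n => plus (u n) (v n)) (plus a b).
Proof.
  intros Hu Hv e He.
  destruct (Hu (e / 2) ltac:(lra)) as [N1 H1]; destruct (Hv (e / 2) ltac:(lra)) as [N2 H2].
  exists (max N1 N2); intros n Hn.
  specialize (H1 n ltac:(lia)); specialize (H2 n ltac:(lia)).
  replace (minus (plus (u n) (v n)) (plus a b)) with (plus (minus (u n) a) (minus (v n) b)) by vmod V.
  eapply Rle_lt_trans; [apply norm_triangle | lra].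
Qed.

Lemma seq_lim_scal {V : CNormed} (k : C) (u : nat -> V) (a : V) :
  seq_lim u a -> seq_lim (fun n => scal (k : C_AbsRing) (u n)) (scal (k : C_AbsRing) a).
Proof.
  intros Hu e He; assert (Hk := Cmod_ge_0 k).
  destruct (Hu (e / (Cmod k + 1))) as [N HN]; [apply Rdiv_lt_0_compat; lra|].
  exists N; intros n Hn; specialize (HN n Hn).
  apply Rle_lt_trans with (norm (scal (k : C_AbsRing) (minus (u n) a))).
  { apply Req_le, norm_eq; vmod V. }
  rewrite norm_scalC.
  apply Rle_lt_trans with ((Cmod k) * (e / (Cmod k + 1))).
  - apply Rmult_le_compat_l; lra.
  - apply Rmult_lt_reg_r with (Cmod k + 1); [lra|].
    replace (Cmod k * (e / (Cmod k + 1)) * (Cmod k + 1)) with (Cmod k * e) by (field; lra); nra.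
Qed.

Lemma seq_lim_unique {V : CNormed} (u : nat -> V) (a b : V) :
  seq_lim u a -> seq_lim u b -> a = b.
Proof.
  intros Ha Hb.
  apply norm_minus_le_0, le_epsilon; intros e He; destruct (Hb e He) as [N HN].
  rewrite Rplus_0_l; apply (seq_lim_norm_le u a b e N Ha).
  intros n Hn; apply Rlt_le, HN, Hn.
Qed.

Lemma seq_complete_blin (U V : CNormed) : seq_complete V ->
  seq_complete (@blin_NormedModule U V).
Proof.
  intros hV u Hu.
  assert (Hpt : forall x, exists l : V, seq_lim (fun n => bfun (u n) x) l).
  { intros x; apply hV; intros e He; assert (Hx := norm_ge_0 x).
    destruct (Hu (e / (norm x + 1))) as [N HN]; [apply Rdiv_lt_0_compat; lra|].
    exists N; intros n m Hn Hm; specialize (HN n m Hn Hm).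
    assert (A := blin_bound (minus (u n) (u m) : blin U V) x).
    eapply Rle_lt_trans; [exact A|].
    apply Rle_lt_trans with (e / (norm x + 1) * norm x).
    - apply Rmult_le_compat_r; [lra | apply Rlt_le, HN].
    - apply Rmult_lt_reg_r with (norm x + 1); [lra|].
      replace (e / (norm x + 1) * norm x * (norm x + 1)) with (norm x * e) by (field; lra); nra. }
  apply choice in Hpt; destruct Hpt as [f Hf].
  (* From [N] on all terms are within distance 1 of [u N], which bounds the pointwise limit by
     [opnorm (u N) + 1]. *)
  destruct (Hu 1 Rlt_0_1) as [N HN].
  assert (Hlin : is_linear f).
  { split.
    - intros x y; apply (seq_lim_unique (fun n => bfun (u n) (plus x y))); [apply Hf|].
      assert (A := seq_lim_plus _ _ _ _ (Hf x) (Hf y)).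
      intros e He; destruct (A e He) as [K HK]; exists K; intros n Hn.
      rewrite (bplus (u n)); exact (HK n Hn).
    - intros k x; apply (seq_lim_unique (fun n => bfun (u n) (scal k x))); [apply Hf|].
      assert (A := seq_lim_scal k _ _ (Hf x)).
      intros e He; destruct (A e He) as [K HK]; exists K; intros n Hn.
      rewrite (bscal (u n)); exact (HK n Hn).
    - exists (opnorm (u N) + 1); assert (H0 := opnorm_ge_0 (u N)); split; [lra|]; intros x.
      assert (A : norm (minus (f x) (bfun (u N) x)) <= norm x).
      { apply (seq_lim_norm_le _ _ _ _ N (Hf x)); intros n Hn.
        assert (B := blin_bound (minus (u n) (u N) : blin U V) x).
        eapply Rle_trans; [exact B|].
        assert (D := HN n N Hn (le_n N)); assert (Hx := norm_ge_0 x).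
        change (opnorm (minus (u n) (u N)) < 1) in D; nra. }
      assert (B := norm_le_minus (f x) (bfun (u N) x)).
      assert (D := blin_bound (u N) x); lra. }
  exists (Blin f Hlin); intros e He.
  destruct (Hu (e / 2) ltac:(lra)) as [K HK]; exists K; intros n Hn.
  apply Rle_lt_trans with (e / 2); [|lra].
  apply (opnorm_le_bound (minus (u n) (Blin f Hlin) : blin U V)); [lra|]; intros x.
  change (norm (minus (bfun (u n) x) (f x)) <= e / 2 * norm x).
  rewrite norm_minus_sym; apply (seq_lim_norm_le _ _ _ _ K (Hf x)); intros m Hm.
  assert (B := blin_bound (minus (u m) (u n) : blin U V) x).
  eapply Rle_trans; [exact B|].
  apply Rmult_le_compat_r; [apply norm_ge_0 | apply Rlt_le, HK; trivial].
Qed.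

Lemma seq_complete_dual (X : CNormed) : seq_complete (dual X).
Proof. apply seq_complete_blin, seq_complete_C. Qed.

(** * The Hahn-Banach theorem *)

(** The preorder form spares antisymmetry: mutually included graphs need not be identified with each
    other. *)
Lemma zorn_preorder {T : Type} (t0 : T) (R : T -> T -> Prop) :
  (forall t, R t t) -> (forall r s t, R r s -> R s t -> R r t) ->
  (forall A : T -> Prop, (forall s t, A s -> A t -> R s t \/ R t s) ->
     exists t, forall s, A s -> R s t) ->
  exists t, forall s, R t s -> R s t.
Proof.
  intros Hrefl Htrans Hchain.
  assert (E : forall s t, is_true (boolp.asbool (R s t)) <-> R s t).
  { intros s t; split; intros H; [exact (boolp.asboolW H) | exact (boolp.asboolT H)]. }
  destruct (@classical_sets.ZL_preorder T t0 (fun s t => boolp.asbool (R s t))) as [t Ht].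
  - intros t; now apply E.
  - intros r s t H1 H2; apply E; apply E in H1, H2; eauto.
  - intros A HA; destruct (Hchain A) as [t Ht].
    + intros s t Hs Ht; destruct (HA s t Hs Ht); [left | right]; now apply E.
    + exists t; intros s Hs; apply E; auto.
  - exists t; intros s Hs; apply E; apply Ht; now apply E.
Qed.

Section HahnBanach.
Context {Y : CNormed} (y0 : Y).

(* The graph of a real-linear functional on a real subspace, dominated by the norm;
   domination makes it single-valued. *)
Record dominated (G : Y -> R -> Prop) : Prop := {
  dom_base : G y0 (norm y0);
  dom_plus : forall x y a b, G x a -> G y b -> G (plus x y) (a + b);
  dom_scal : forall r x a, G x a -> G (scal (RtoC r : C_AbsRing) x) (r * a);
  dom_le : forall x a, G x a -> a <= norm x }.

Lemma dominated_fun G x a b : dominated G -> G x a -> G x b -> a = b.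
Proof.
  intros HG Ha Hb.
  assert (Hle : forall c d, G x c -> G x d -> c <= d).
  { intros c d Hc Hd.
    assert (A := dom_le _ HG _ _ (dom_plus _ HG _ _ _ _ Hc (dom_scal _ HG (-1) _ _ Hd))).
    assert (E : norm (plus x (scal (RtoC (-1) : C_AbsRing) x)) = 0).
    { rewrite <- (norm_minus_self x); f_equal.
      replace (RtoC (-1)) with (Copp 1) by (rewrite <- RtoC_opp; f_equal; ring); vmod Y. }
    lra. }
  apply Rle_antisym; auto.
Qed.

Lemma dominated_line : dominated (fun x a => exists r, x = scal (RtoC r : C_AbsRing) y0 /\ a = r * norm y0).
Proof.
  split.
  - exists 1; split; [symmetry; apply scalC_one | ring].
  - intros x y a b [r [-> ->]] [s [-> ->]]; exists (r + s); split; [|ring].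
    rewrite RtoC_plus; vmod Y.
  - intros s x a [r [-> ->]]; exists (s * r); split; [|ring].
    rewrite RtoC_mult; apply scalC_assoc.
  - intros x a [r [-> ->]]; rewrite norm_scalR.
    apply Rmult_le_compat_r; [apply norm_ge_0 | apply Rle_abs].
Qed.

(** The value at [x0] must lie between all a - |x - x0| and all |y + x0| - b; their supremum
    qualifies. The case of [x0] already in the domain needs no separation: the two bounds then force
    the value, and domination keeps the new graph single-valued. *)
Lemma dominated_extend G (x0 : Y) : dominated G ->
  exists G', dominated G' /\ (forall x a, G x a -> G' x a) /\ exists a, G' x0 a.
Proof.
  intros HG.
  assert (G0 : G zero 0).
  { assert (A := dom_scal _ HG 0 _ _ (dom_base _ HG)); rewrite Rmult_0_l in A.
    replace (zero : Y) with (scal (RtoC 0 : C_AbsRing) y0); [exact A | vmod Y]. }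
  destruct (completeness (fun r => exists x a, G x a /\ r = a - norm (minus x x0))) as [xi [Hub Hlub]].
  { exists (norm x0); intros r [x [a [Ha ->]]].
    assert (A := dom_le _ HG _ _ Ha); assert (B := norm_le_minus x x0); lra. }
  { exists (0 - norm (minus zero x0)), zero, 0; split; trivial. }
  assert (L1 : forall x a, G x a -> a - norm (minus x x0) <= xi).
  { intros x a H; apply Hub; now exists x, a. }
  assert (L2 : forall y b, G y b -> xi <= norm (plus y x0) - b).
  { intros y b Hb; apply Hlub; intros r [x [a [Ha ->]]].
    assert (A := dom_le _ HG _ _ (dom_plus _ HG _ _ _ _ Ha Hb)).
    assert (B : norm (plus x y) <= norm (minus x x0) + norm (plus y x0)).
    { replace (plus x y) with (plus (minus x x0) (plus y x0)) by vmod Y; apply norm_triangle. }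
    lra. }
  exists (fun z c => exists x a r, G x a /\ z = plus x (scal (RtoC r : C_AbsRing) x0) /\ c = a + r * xi).
  split; [split|split].
  - exists y0, (norm y0), 0; split; [apply HG|split; [vmod Y | ring]].
  - intros z w c d [x [a [r [H1 [-> ->]]]]] [y [b [s [H2 [-> ->]]]]].
    exists (plus x y), (a + b), (r + s); split; [now apply HG|split; [|ring]].
    rewrite RtoC_plus; vmod Y.
  - intros s z c [x [a [r [H [-> ->]]]]].
    exists (scal (RtoC s : C_AbsRing) x), (s * a), (s * r); split; [now apply HG|split; [|ring]].
    rewrite RtoC_mult; vmod Y.
  - intros z c [x [a [r [H [-> ->]]]]].
    (* Dividing by |r| reduces domination to [L1] for r < 0 and to [L2] for r > 0. *)
    destruct (Rtotal_order r 0) as [Hr|[Hr|Hr]].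
    + assert (Hi : 0 < - / r) by (assert (/ r < 0) by (now apply Rinv_lt_0_compat); lra).
      assert (A : - / r * a - - / r * norm (plus x (scal (RtoC r : C_AbsRing) x0)) <= xi).
      { rewrite <- scalR_pos by lra; eapply Rle_trans; [|exact (L1 _ _ (dom_scal _ HG (- / r) _ _ H))].
        apply Rplus_le_compat_l, Ropp_le_contravar, Req_le, norm_eq.
        rewrite scalC_plus_r, scalC_assoc, <- RtoC_mult.
        replace (- / r * r) with (-1) by (field; lra).
        replace (RtoC (-1)) with (Copp 1) by (rewrite <- RtoC_opp; f_equal; ring); vmod Y. }
      set (n := norm (plus x _)) in *.
      assert (B : (- r) * (- / r * a - - / r * n) <= (- r) * xi) by (apply Rmult_le_compat_l; lra).
      replace ((- r) * (- / r * a - - / r * n)) with (a - n) in B by (field; lra); lra.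
    + subst r; rewrite Rmult_0_l, Rplus_0_r.
      replace (plus x (scal (RtoC 0 : C_AbsRing) x0)) with x by vmod Y; now apply HG.
    + assert (Hi : 0 < / r) by now apply Rinv_0_lt_compat.
      assert (A : xi <= / r * norm (plus x (scal (RtoC r : C_AbsRing) x0)) - / r * a).
      { rewrite <- scalR_pos by lra; eapply Rle_trans; [exact (L2 _ _ (dom_scal _ HG (/ r) _ _ H))|].
        apply Rplus_le_compat_r, Req_le, norm_eq.
        rewrite scalC_plus_r, scalC_assoc, <- RtoC_mult, Rinv_l by lra; vmod Y. }
      set (n := norm (plus x _)) in *.
      assert (B : r * xi <= r * (/ r * n - / r * a)) by (apply Rmult_le_compat_l; lra).
      replace (r * (/ r * n - / r * a)) with (n - a) in B by (field; lra); lra.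
  - intros x a H; exists x, a, 0; split; [trivial|split; [vmod Y | ring]].
  - exists (0 + 1 * xi), zero, 0, 1; split; [trivial|split; [vmod Y | reflexivity]].
Qed.

Lemma dominated_total : exists G, dominated G /\ forall x, exists a, G x a.
Proof.
  set (D := {G : Y -> R -> Prop | dominated G}).
  destruct (zorn_preorder (exist _ _ dominated_line : D)
    (fun G H => forall x a, proj1_sig G x a -> proj1_sig H x a)) as [[G HG] Hmax].
  - auto.
  - eauto.
  - intros A HA.
    (* The union of an empty chain would miss [dom_base], so that case falls back on the line
       through [y0]. *)
    destruct (classic (exists G, A G)) as [[G1 H1]|Hempty].
    2:{ exists (exist _ _ dominated_line); intros s Hs; exfalso; eauto. }
    assert (HU : dominated (fun x a => exists G, A G /\ proj1_sig G x a)).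
    { split.
      - exists G1; split; trivial; apply (proj2_sig G1).
      - intros x y a b [G [HG Ha]] [H [HH Hb]].
        destruct (HA G H HG HH) as [I|I].
        + exists H; split; trivial; apply (proj2_sig H); auto.
        + exists G; split; trivial; apply (proj2_sig G); auto.
      - intros r x a [G [HG Ha]]; exists G; split; trivial; now apply (proj2_sig G).
      - intros x a [G [HG Ha]]; now apply (dom_le _ (proj2_sig G)). }
    exists (exist _ _ HU); intros G HG x a Ha; simpl; eauto.
  - exists G; split; trivial; intros x0.
    destruct (dominated_extend G x0 HG) as [G' [HG' [Hsub [a Ha]]]].
    exists a; exact (Hmax (exist _ G' HG') Hsub x0 a Ha).
Qed.

Lemma norming_functional : exists phi : dual Y,
  opnorm phi <= 1 /\ norm y0 <= Cmod (bfun phi y0).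
Proof.
  destruct dominated_total as [G [HG Htot]].
  apply choice in Htot; destruct Htot as [f Hf].
  assert (Huniq : forall x a, G x a -> f x = a) by (intros x a Ha; now apply (dominated_fun G x)).
  assert (Fplus : forall x y, f (plus x y) = f x + f y) by (intros; apply Huniq, HG; auto).
  assert (Fscal : forall r x, f (scal (RtoC r : C_AbsRing) x) = r * f x) by (intros; apply Huniq, HG; auto).
  assert (Fle : forall x, f x <= norm x) by (intros; now apply (dom_le _ HG)).
  set (J x := scal (Ci : C_AbsRing) x : Y).
  (* The complex-linear functional with real part f, x -> f(x) - i f(ix). Its modulus at [y0] is at
     least its real part, which is the norm of [y0]. *)
  set (phi x := (f x, - f (J x)) : C).
  assert (Pscal : forall (k : C) x, phi (scal (k : C_AbsRing) x) = Cmult k (phi x)).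
  { intros [p q] x.
    assert (E : scal ((p, q) : C_AbsRing) x
      = plus (scal (RtoC p : C_AbsRing) x) (scal (RtoC q : C_AbsRing) (J x))).
    { unfold J; rewrite scalC_assoc, <- scalC_plus_l; f_equal.
      unfold RtoC, Cplus, Cmult, Ci; simpl; f_equal; ring. }
    assert (E' : J (scal ((p, q) : C_AbsRing) x)
      = plus (scal (RtoC p : C_AbsRing) (J x)) (scal (RtoC (- q) : C_AbsRing) x)).
    { unfold J; rewrite !scalC_assoc, <- scalC_plus_l; f_equal.
      unfold RtoC, Cplus, Cmult, Ci; simpl; f_equal; ring. }
    unfold phi; rewrite E', E, !Fplus, !Fscal; unfold Cmult; simpl; f_equal; ring. }
  assert (Pbound : forall x, Cmod (phi x) <= norm x).
  { intros x; destruct (Req_dec (Cmod (phi x)) 0) as [E|E].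
    { rewrite E; apply norm_ge_0. }
    assert (Hp := Cmod_ge_0 (phi x)).
    (* Rotating x by k makes phi real, so that the bound on f applies. *)
    set (k := Cmult (Cconj (phi x)) (RtoC (/ Cmod (phi x)))).
    assert (Hk : Cmod k = 1).
    { unfold k; rewrite Cmod_mult, Cmod_conj, Cmod_R, Rabs_pos_eq.
      - now apply Rinv_r.
      - apply Rlt_le, Rinv_0_lt_compat; lra. }
    assert (Hkp : Cmult k (phi x) = RtoC (Cmod (phi x))).
    { unfold k; replace (Cmult (Cmult (Cconj (phi x)) (RtoC (/ Cmod (phi x)))) (phi x))
        with (Cmult (RtoC (/ Cmod (phi x))) (Cmult (phi x) (Cconj (phi x)))) by ring.
      rewrite <- Cmod2_conj, <- RtoC_mult; f_equal; field; trivial. }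
    rewrite <- Pscal in Hkp; apply (f_equal fst) in Hkp; simpl in Hkp.
    rewrite <- Hkp; eapply Rle_trans; [apply Fle|].
    rewrite norm_scalC, Hk; lra. }
  assert (Plin : is_linear (U := Y) (V := C_NormedModule) phi).
  { split.
    - intros x y; unfold phi, J; rewrite scalC_plus_r, !Fplus.
      change (plus (?a, ?b) (?c, ?d)) with (Cplus (a, b) (c, d)).
      unfold Cplus; simpl; f_equal; ring.
    - exact Pscal.
    - exists 1; split; [lra|]; intros x; rewrite Rmult_1_l; exact (Pbound x). }
  exists (Blin phi Plin : blin Y C_NormedModule); split.
  - apply opnorm_le_bound; [lra|]; intros x; rewrite Rmult_1_l; exact (Pbound x).
  - apply Rle_trans with (Rabs (fst (phi y0))).
    + simpl; rewrite (Huniq y0 (norm y0) (dom_base _ HG)); apply Rle_abs.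
    + apply (Rle_trans _ _ _ (Rmax_l _ _) (Rmax_Cmod (phi y0))).
Qed.

End HahnBanach.

(** * Semigroups and generators *)

Section Generator.
Context {X : CNormed} (A : operator X) (T : R -> blin X X) (hA : generates A T).

Lemma semigroup_zero x : T 0 x = x.
Proof. apply hA. Qed.

Lemma semigroup_plus s t x : 0 <= s -> 0 <= t -> T (s + t) x = T s (T t x).
Proof. intros; now apply hA. Qed.

Lemma semigroup_comm s t x : 0 <= s -> 0 <= t -> T s (T t x) = T t (T s x).
Proof. intros; rewrite <- !semigroup_plus by trivial; f_equal; f_equal; ring. Qed.

Lemma semigroup_right x e : 0 < e ->
  exists d, 0 < d /\ forall h, 0 < h < d -> norm (minus (T h x) x) < e.
Proof. apply filterlim_right0, hA. Qed.

(** First-order expansion with error o(h): free of division, it can be mapped through bounded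
    operators and added term by term. *)
Lemma generator_increment x y :
  A x y <-> forall e, 0 < e -> exists d, 0 < d /\ forall h, 0 < h < d ->
    norm (minus (T h x) (plus x (scal (RtoC h : C_AbsRing) y))) <= e * h.
Proof.
  etransitivity; [apply hA|]; etransitivity; [apply filterlim_right0|].
  assert (E : forall h, 0 < h ->
    norm (minus (T h x) (plus x (scal (RtoC h : C_AbsRing) y)))
    = h * norm (minus (scal (RtoC (/ h) : C_AbsRing) (minus (T h x) x)) y)).
  { intros h Hh; rewrite <- scalR_pos by lra; apply norm_eq.
    transitivity (minus (scal (Cmult (RtoC h) (RtoC (/ h)) : C_AbsRing) (minus (T h x) x))
                    (scal (RtoC h : C_AbsRing) y)).
    - rewrite <- RtoC_mult, Rinv_r by lra; vmod X.
    - vmod X. }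
  split; intros H e He.
  - destruct (H e He) as [d [Hd Hh]]; exists d; split; trivial; intros h Hh'.
    rewrite E, (Rmult_comm e) by lra; apply Rmult_le_compat_l; [lra | exact (Rlt_le _ _ (Hh h Hh'))].
  - destruct (H (e / 2) ltac:(lra)) as [d [Hd Hh]]; exists d; split; trivial; intros h Hh'.
    specialize (Hh h Hh'); rewrite E in Hh by lra.
    apply Rle_lt_trans with (e / 2); [|lra].
    apply Rmult_le_reg_l with h; [lra | rewrite (Rmult_comm h (e / 2)); exact Hh].
Qed.

Lemma generator_semigroup t x y : 0 <= t -> A x y -> A (T t x) (T t y).
Proof.
  intros Ht; rewrite !generator_increment; intros H e He.
  assert (H0 := opnorm_ge_0 (T t)).
  destruct (H (e / (opnorm (T t) + 1))) as [d [Hd Hh]]; [apply Rdiv_lt_0_compat; lra|].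
  exists d; split; trivial; intros h Hh'; specialize (Hh h Hh').
  rewrite semigroup_comm by lra.
  rewrite <- bscal, <- bplus, <- bminus.
  eapply Rle_trans; [apply blin_bound|].
  apply Rle_trans with (opnorm (T t) * (e / (opnorm (T t) + 1) * h)).
  - now apply Rmult_le_compat_l.
  - apply Rmult_le_reg_r with (opnorm (T t) + 1); [lra|].
    replace (opnorm (T t) * (e / (opnorm (T t) + 1) * h) * (opnorm (T t) + 1))
      with (opnorm (T t) * (e * h)) by (field; lra).
    assert (0 < e * h) by (apply Rmult_lt_0_compat; lra); nra.
Qed.

Section Inverse.
Context (L : blin X X) (hL : is_bounded_inverse A L).

Lemma inverse_generator y : A (L y) y.
Proof. now apply hL. Qed.

Lemma inverse_semigroup t y : 0 <= t -> L (T t y) = T t (L y).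
Proof. intros Ht; apply hL, generator_semigroup, inverse_generator; trivial. Qed.

(* A^-1 ((T h x - x) / h) is the difference quotient of T at A^-1 x, so it tends to x. *)
Lemma domain_dense x e : 0 < e -> exists x', dom A x' /\ norm (minus x x') <= e.
Proof.
  intros He.
  destruct (proj1 (generator_increment (L x) x) (inverse_generator x) e He) as [d [Hd H]].
  set (h := d / 2); specialize (H h ltac:(unfold h; lra)).
  assert (Hh : 0 < h) by (unfold h; lra).
  set (q := scal (RtoC (/ h) : C_AbsRing) (minus (T h x) x)).
  exists (L q); split; [exists q; apply inverse_generator|].
  rewrite norm_minus_sym; apply Rmult_le_reg_l with h; trivial; rewrite (Rmult_comm h e).
  eapply Rle_trans; [|exact H].
  rewrite <- scalR_pos by lra; apply Req_le, norm_eq.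
  unfold q; rewrite bscal, bminus, inverse_semigroup by lra.
  transitivity (minus (scal (Cmult (RtoC h) (RtoC (/ h)) : C_AbsRing) (minus (T h (L x)) (L x)))
                    (scal (RtoC h : C_AbsRing) x)); [vmod X|].
  rewrite <- RtoC_mult, Rinv_r by lra; vmod X.
Qed.

End Inverse.

Lemma dense_bound {V : CNormed} (f : blin X V) (M : R) : 0 <= M ->
  (forall x e, 0 < e -> exists x', dom A x' /\ norm (minus x x') <= e) ->
  (forall x, dom A x -> norm (f x) <= M * norm x) -> forall x, norm (f x) <= M * norm x.
Proof.
  intros HM Hd Hf x; apply le_epsilon; intros e He.
  assert (H0 := opnorm_ge_0 f).
  destruct (Hd x (e / (opnorm f + M + 1))) as [x' [Hx' Hn]]; [apply Rdiv_lt_0_compat; lra|].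
  assert (B := Hf x' Hx').
  assert (C1 := norm_le_minus (f x) (f x')); rewrite <- bminus in C1.
  assert (C2 := blin_bound f (minus x x')).
  assert (C3 := norm_le_minus x' x); rewrite norm_minus_sym in C3.
  set (n := norm (minus x x')) in *.
  assert (C4 : (opnorm f + M) * n <= e).
  { apply Rle_trans with ((opnorm f + M) * (e / (opnorm f + M + 1))); [apply Rmult_le_compat_l; lra|].
    apply Rmult_le_reg_r with (opnorm f + M + 1); [lra|].
    replace ((opnorm f + M) * (e / (opnorm f + M + 1)) * (opnorm f + M + 1))
      with ((opnorm f + M) * e) by (field; lra); nra. }
  assert (M * norm x' <= M * (n + norm x)) by (apply Rmult_le_compat_l; lra); lra.
Qed.

(* If Q is the supremum of |Lam T(tau) x|, then T(h) x = (1 + h s) x - h (s x - A x) + o(h)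
   gives (1 + h s) Q <= Q + h N + o(h). *)
Lemma resolvent_bound {V : CNormed} (Lam : blin X V) (K N s : R) (x y : X) :
  (forall t, 0 <= t -> opnorm (T t) <= K) -> 0 < s -> A x y ->
  (forall t, 0 <= t -> norm (Lam (T t (minus (scal (RtoC s : C_AbsRing) x) y))) <= N) ->
  norm (Lam x) <= N / s.
Proof.
  intros HK Hs Hxy HN.
  assert (HL := opnorm_ge_0 Lam).
  assert (HK0 : 0 <= K) by (apply Rle_trans with (2 := HK 0 (Rle_refl 0)), opnorm_ge_0).
  assert (Hall : forall t v, 0 <= t -> norm (Lam (T t v)) <= opnorm Lam * K * norm v).
  { intros t v Ht; eapply Rle_trans; [apply blin_bound|]; rewrite Rmult_assoc.
    apply Rmult_le_compat_l; trivial; apply blin_bound_le; auto. }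
  destruct (completeness (fun r => exists t, 0 <= t /\ r = norm (Lam (T t x)))) as [Q [Hub Hlub]].
  { exists (opnorm Lam * K * norm x); intros r [t [Ht ->]]; now apply Hall. }
  { exists (norm (Lam (T 0 x))), 0; split; [lra | trivial]. }
  assert (HxQ : norm (Lam x) <= Q) by (apply Hub; exists 0; rewrite semigroup_zero; split; [lra | trivial]).
  apply Rle_trans with (1 := HxQ).
  apply Rmult_le_reg_r with s; trivial.
  replace (N / s * s) with N by (field; lra).
  apply le_epsilon; intros e He.
  set (c := opnorm Lam * K) in *.
  assert (Hc : 0 <= c) by (unfold c; now apply Rmult_le_pos).
  destruct (proj1 (generator_increment x y) Hxy (e / (c + 1))) as [d [Hd H]].
  { apply Rdiv_lt_0_compat; lra. }
  set (h := d / 2); specialize (H h ltac:(unfold h; lra)).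
  assert (Hh : 0 < h) by (unfold h; lra).
  set (z := minus (scal (RtoC s : C_AbsRing) x) y) in *.
  set (w := minus (T h x) (plus x (scal (RtoC h : C_AbsRing) y))) in *.
  assert (Hw : c * norm w <= e * h).
  { apply Rle_trans with (c * (e / (c + 1) * h)); [now apply Rmult_le_compat_l|].
    apply Rmult_le_reg_r with (c + 1); [lra|].
    replace (c * (e / (c + 1) * h) * (c + 1)) with (c * (e * h)) by (field; lra).
    assert (0 < e * h) by (apply Rmult_lt_0_compat; lra); nra. }
  assert (Hsup : Q <= (Q + h * N + e * h) / (1 + h * s)).
  { apply Hlub; intros r [t [Ht ->]].
    assert (Hp : 0 < 1 + h * s) by nra.
    apply Rmult_le_reg_l with (1 + h * s); trivial.
    replace ((1 + h * s) * ((Q + h * N + e * h) / (1 + h * s))) with (Q + h * N + e * h) by (field; lra).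
    rewrite <- scalR_pos by lra.
    assert (Hq : norm (Lam (T (t + h) x)) <= Q) by (apply Hub; exists (t + h); split; [lra | trivial]).
    assert (E : scal (RtoC (1 + h * s) : C_AbsRing) x
      = plus (minus (T h x) w) (scal (RtoC h : C_AbsRing) z)).
    { unfold w, z; rewrite RtoC_plus, RtoC_mult; vmod X. }
    assert (E' : Lam (T t (scal (RtoC (1 + h * s) : C_AbsRing) x))
      = plus (minus (Lam (T (t + h) x)) (Lam (T t w))) (Lam (T t (scal (RtoC h : C_AbsRing) z)))).
    { rewrite E, semigroup_plus by lra.
      etransitivity; [apply f_equal, bplus|]; etransitivity; [apply bplus|]; f_equal.
      etransitivity; [apply f_equal, bminus | apply bminus]. }
    rewrite <- !bscal, E'.
    eapply Rle_trans; [apply norm_triangle|].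
    assert (B1 := norm_minus_le (Lam (T (t + h) x)) (Lam (T t w))).
    assert (B2 := Hall t w Ht).
    assert (B3 : norm (Lam (T t (scal (RtoC h : C_AbsRing) z))) <= h * N).
    { rewrite !bscal, scalR_pos by lra; apply Rmult_le_compat_l; [lra | now apply HN]. }
    lra. }
  assert (Hp : 0 < 1 + h * s) by nra.
  apply (Rmult_le_compat_l (1 + h * s)) in Hsup; [|lra].
  replace ((1 + h * s) * ((Q + h * N + e * h) / (1 + h * s))) with (Q + h * N + e * h) in Hsup by (field; lra).
  apply Rmult_le_reg_l with h; trivial; lra.
Qed.

(** Otherwise some s_n -> 0 have unbounded operator norms. Every orbit is bounded along s_n by
    convergence at 0, up to finitely many indices, against Banach-Steinhaus. *)
Lemma semigroup_bounded_near_zero : seq_complete X ->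
  exists d K, 0 < d /\ forall s, 0 <= s <= d -> opnorm (T s) <= K.
Proof.
  intros hX; apply NNPP; intros Hn.
  assert (Hbig : forall n : nat, exists s, 0 <= s <= / (INR n + 1) /\ INR n < opnorm (T s)).
  { intros n; apply NNPP; intros Hn'; apply Hn; exists (/ (INR n + 1)), (INR n).
    assert (Hi := pos_INR n); split; [apply Rinv_0_lt_compat; lra|].
    intros s Hs; apply Rnot_lt_le; intros Hlt; apply Hn'; exists s; split; trivial. }
  apply choice in Hbig; destruct Hbig as [s Hs].
  destruct (uniform_boundedness hX (fun f => exists n, f = T (s n))) as [M [_ HM]].
  - intros x.
    destruct (semigroup_right x 1 Rlt_0_1) as [d [Hd Hx]].
    destruct (INR_archimed d 1 Hd) as [N HN].
    assert (Hfin : exists M, forall n, (n < N)%nat -> norm (T (s n) x) <= M).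
    { clear HN; induction N as [|N [M HM]].
      - exists 0; intros n Hn'; lia.
      - exists (Rmax M (norm (T (s N) x))); intros n Hn'.
        destruct (Nat.eq_dec n N) as [->|Hne]; [apply Rmax_r|].
        apply Rle_trans with (2 := Rmax_l _ _); apply HM; lia. }
    destruct Hfin as [M HM]; exists (Rmax M (norm x + 1)); intros f [n ->].
    destruct (Nat.lt_ge_cases n N) as [Hlt|Hge].
    { apply Rle_trans with (2 := Rmax_l _ _); auto. }
    apply Rle_trans with (2 := Rmax_r _ _).
    destruct (Hs n) as [[H1 H2] _].
    destruct (Req_dec (s n) 0) as [E|E]; [rewrite E, semigroup_zero; lra|].
    assert (Hlt : s n < d).
    { apply Rle_lt_trans with (1 := H2).
      apply le_INR in Hge; assert (H0 := pos_INR n).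
      apply Rmult_lt_reg_l with (INR n + 1); [lra|]; rewrite Rinv_r by lra; nra. }
    assert (B := Hx (s n) ltac:(lra)); assert (D := norm_le_minus (T (s n) x) x); lra.
  - destruct (INR_archimed 1 M Rlt_0_1) as [n Hn'].
    assert (B := HM (T (s n)) (ex_intro _ n eq_refl)); destruct (Hs n) as [_ H]; lra.
Qed.

(** Serves the semigroup of the operator matrix, for which no global bound is known when the Duhamel
    estimate is applied. *)
Lemma semigroup_bounded_on : seq_complete X ->
  forall t, exists K, forall s, 0 <= s <= t -> opnorm (T s) <= K.
Proof.
  intros hX; destruct (semigroup_bounded_near_zero hX) as [d [K [Hd HK]]].
  assert (HK0 : 0 <= K) by (apply Rle_trans with (2 := HK 0 ltac:(lra)), opnorm_ge_0).
  assert (Hn : forall n : nat, exists M, 0 <= M /\ forall s, 0 <= s <= INR n * d -> opnorm (T s) <= M).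
  { induction n as [|n [M [HM0 HM]]].
    - exists K; split; trivial; intros s Hs; simpl in Hs; apply HK; lra.
    - exists (Rmax M (K * M)); split; [apply Rle_trans with (2 := Rmax_l _ _); trivial|].
      intros s Hs; rewrite S_INR in Hs.
      destruct (Rle_lt_dec s (INR n * d)) as [Hle|Hlt].
      + apply Rle_trans with (2 := Rmax_l _ _), HM; lra.
      + assert (H0 : 0 <= INR n * d) by (apply Rmult_le_pos; [apply pos_INR | lra]).
        apply Rle_trans with (2 := Rmax_r _ _).
        apply opnorm_le_bound; [now apply Rmult_le_pos|]; intros x.
        replace s with (s - INR n * d + INR n * d) by ring; rewrite semigroup_plus by lra.
        rewrite Rmult_assoc; eapply Rle_trans; [apply (blin_bound_le _ _ K), HK; lra|].
        apply Rmult_le_compat_l; trivial; apply blin_bound_le, HM; lra. }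
  intros t; destruct (INR_archimed d t Hd) as [n Hn'].
  destruct (Hn n) as [M [_ HM]]; exists M; intros s Hs; apply HM; lra.
Qed.

(** T(s)x - T(r)x = T(r)(T(s-r)x - x), so local boundedness turns right continuity at 0 into left
    continuity. *)
Lemma semigroup_left_continuous (K t : R) (x : X) :
  (forall s, 0 <= s <= t -> opnorm (T s) <= K) ->
  forall s, 0 < s <= t -> forall e, 0 < e ->
    exists d, 0 < d /\ forall r, 0 <= r -> s - d < r < s -> norm (minus (T s x) (T r x)) <= e.
Proof.
  intros HK s Hs e He.
  assert (HK0 : 0 <= K) by (apply Rle_trans with (2 := HK 0 ltac:(lra)), opnorm_ge_0).
  destruct (semigroup_right x (e / (K + 1))) as [d [Hd H]]; [apply Rdiv_lt_0_compat; lra|].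
  exists d; split; trivial; intros r Hr0 Hr.
  replace s with (r + (s - r)) by ring; rewrite semigroup_plus by lra.
  rewrite <- bminus.
  eapply Rle_trans; [apply (blin_bound_le _ _ K), HK; lra|].
  specialize (H (s - r) ltac:(lra)).
  apply Rle_trans with (K * (e / (K + 1))); [apply Rmult_le_compat_l; lra|].
  apply Rmult_le_reg_r with (K + 1); [lra|].
  replace (K * (e / (K + 1)) * (K + 1)) with (K * e) by (field; lra); nra.
Qed.

End Generator.

(** * Decay on domains of fractional powers *)

Lemma Rpower_pos x y : 0 < Rpower x y.
Proof. apply exp_pos. Qed.

Lemma Riemann_sum_blin {U V : CNormed} (P : blin U V) (f : R -> real_NormedModule U) ptd :
  Riemann_sum (fun s => P (f s) : real_NormedModule V) ptd
  = P (Riemann_sum f ptd : real_NormedModule U).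
Proof.
  apply (SF_cons_ind (fun ptd => Riemann_sum (fun s => P (f s) : real_NormedModule V) ptd
    = P (Riemann_sum f ptd : real_NormedModule U))).
  - intros x; symmetry; apply bzero.
  - intros h s IH; rewrite !Riemann_sum_cons, IH; symmetry.
    etransitivity; [apply bplus|].
    f_equal; exact (bscal P (RtoC (SF_h s - fst h) : C_AbsRing) _).
Qed.

Lemma is_RInt_blin {U V : CNormed} (P : blin U V) (f : R -> real_NormedModule U) a b I :
  is_RInt f a b I -> is_RInt (fun s => P (f s) : real_NormedModule V) a b (P I).
Proof.
  intros H; unfold is_RInt.
  assert (Hc : filterlim (fun x => P x) (locally I) (locally (P I))).
  { apply (linear_cont (fun x => P x) I), blin_linear. }
  eapply filterlim_ext; [|exact (filterlim_comp _ _ _ _ _ _ _ _ H Hc)].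
  intros ptd; cbn beta.
  transitivity (scal (RtoC (sign (b - a)) : C_AbsRing) (P (Riemann_sum f ptd : real_NormedModule U))).
  - exact (bscal P (RtoC (sign (b - a)) : C_AbsRing) _).
  - rewrite <- Riemann_sum_blin; reflexivity.
Qed.

Lemma is_RInt_Rpower (p a b : R) : 0 < a -> a <= b -> p + 1 <> 0 ->
  is_RInt (fun s => Rpower s p) a b ((Rpower b (p + 1) - Rpower a (p + 1)) / (p + 1)).
Proof.
  intros Ha Hab Hp.
  replace ((Rpower b (p + 1) - Rpower a (p + 1)) / (p + 1))
    with (minus (Rpower b (p + 1) / (p + 1)) (Rpower a (p + 1) / (p + 1)))
    by (unfold minus, plus, opp; simpl; field; trivial).
  rewrite <- (Rmin_left a b) in Ha by trivial.
  apply (is_RInt_derive (V := R_CompleteNormedModule) (fun s => Rpower s (p + 1) / (p + 1))).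
  - intros x Hx; assert (Hx0 : 0 < x) by lra.
    replace (Rpower x p) with (/ (p + 1) * ((p + 1) * Rpower x (p + 1 - 1))).
    2:{ replace (p + 1 - 1) with p by ring; field; trivial. }
    apply is_derive_ext with (fun s => / (p + 1) * Rpower s (p + 1)).
    { intros t; exact (Rmult_comm (/ (p + 1)) (Rpower t (p + 1))). }
    apply (is_derive_scal (fun s => Rpower s (p + 1))).
    apply is_derive_Reals, derivable_pt_lim_power; trivial.
  - intros x Hx; assert (Hx0 : 0 < x) by lra.
    apply (ex_derive_continuous (fun s => Rpower s p)).
    exists (p * Rpower x (p - 1)); apply is_derive_Reals, derivable_pt_lim_power; trivial.
Qed.

(* Splitting the Balakrishnan integral at N gives the moment inequality. *)
Lemma neg_frac_pow_bound {V : CNormed} (S : operator V) (theta : R) (P : blin V V)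
    (z v : V) (k1 k2 N : R) :
  0 < theta < 1 -> 0 <= k1 -> 0 <= k2 -> 0 < N ->
  (forall s u, 0 < s -> op_shift (RtoC s) S u z -> norm (P u) <= k1 /\ s * norm (P u) <= k2) ->
  neg_frac_pow S theta z v ->
  norm (P v) <= k1 * (Rpower N (1 - theta) / (1 - theta)) + k2 * (Rpower N (- theta) / theta).
Proof.
  intros Hth Hk1 Hk2 HN HS [Res [w [HRes [Hint ->]]]].
  set (bound := k1 * (Rpower N (1 - theta) / (1 - theta)) + k2 * (Rpower N (- theta) / theta)).
  set (f := fun s => scal (Rpower s (- theta) : R_AbsRing) (Res s z : real_NormedModule V)) in *.
  assert (Hf : forall s, norm (P (f s)) = Rpower s (- theta) * norm (P (Res s z))).
  { intros s; rewrite <- scalR_pos by apply Rlt_le, Rpower_pos.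
    apply norm_eq; exact (bscal P (RtoC (Rpower s (- theta)) : C_AbsRing) (Res s z)). }
  assert (HR : forall s, 0 < s -> norm (P (Res s z)) <= k1 /\ s * norm (P (Res s z)) <= k2).
  { intros s Hs; apply HS; trivial; now apply (HRes s Hs). }
  assert (Hpart : forall a b I, 0 < a -> a <= N -> N <= b -> is_RInt f a b I -> norm (P I) <= bound).
  { intros a b I Ha HaN HNb HI.
    (* Majorant of the integrand: the bound [k1] up to [N], the bound [k2]/s beyond it. With 0 <
       theta < 1 the first piece is integrable at 0 and the second at infinity. *)
    set (g := fun s => if Rle_dec s N then k1 * Rpower s (- theta) else k2 * Rpower s (- theta - 1)).
    set (l1 := k1 * ((Rpower N (- theta + 1) - Rpower a (- theta + 1)) / (- theta + 1))).
    set (l2 := k2 * ((Rpower b (- theta - 1 + 1) - Rpower N (- theta - 1 + 1)) / (- theta - 1 + 1))).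
    assert (Hg : is_RInt g a b (l1 + l2)).
    { apply (is_RInt_Chasles (V := R_NormedModule) g a N b l1 l2).
      - apply is_RInt_ext with (fun s => scal k1 (Rpower s (- theta))).
        + intros s; rewrite Rmin_left, Rmax_right by trivial; intros Hs.
          unfold g; destruct (Rle_dec s N); [reflexivity | lra].
        + apply (is_RInt_scal (V := R_NormedModule)), is_RInt_Rpower; lra.
      - apply is_RInt_ext with (fun s => scal k2 (Rpower s (- theta - 1))).
        + intros s; rewrite Rmin_left, Rmax_right by trivial; intros Hs.
          unfold g; destruct (Rle_dec s N); [lra | reflexivity].
        + apply (is_RInt_scal (V := R_NormedModule)), is_RInt_Rpower; lra. }
    apply Rle_trans with (l1 + l2).
    - apply (norm_RInt_le (V := real_NormedModule V) (fun s => P (f s)) g a b); trivial.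
      + lra.
      + intros s Hs.
        change (norm (P (f s)) <= g s).
        rewrite Hf; destruct (HR s ltac:(lra)) as [H1 H2].
        assert (H0 := Rpower_pos s (- theta)).
        unfold g; destruct (Rle_dec s N); [rewrite (Rmult_comm k1); apply Rmult_le_compat_l; lra|].
        apply Rmult_le_reg_l with s; [lra|].
        replace (- theta - 1) with (- theta + - (1)) by ring.
        rewrite Rpower_plus, (Rpower_Ropp s 1), Rpower_1 by lra.
        replace (s * (k2 * (Rpower s (- theta) * / s))) with (Rpower s (- theta) * k2) by (field; lra).
        rewrite <- Rmult_assoc, (Rmult_comm s), Rmult_assoc; apply Rmult_le_compat_l; lra.
      + now apply is_RInt_blin.
    (* The boundary terms at [a] and [b] have the favourable sign; dropping them makes the bound
       independent of the interval. *)
    - unfold l1, l2, bound.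
      replace (- theta + 1) with (1 - theta) by ring; replace (- theta - 1 + 1) with (- theta) by ring.
      apply Rplus_le_compat; apply Rmult_le_compat_l; trivial.
      + apply Rmult_le_compat_r; [apply Rlt_le, Rinv_0_lt_compat; lra|].
        assert (H := Rpower_pos a (1 - theta)); lra.
      + replace ((Rpower b (- theta) - Rpower N (- theta)) / - theta)
          with ((Rpower N (- theta) - Rpower b (- theta)) / theta) by (field; lra).
        apply Rmult_le_compat_r; [apply Rlt_le, Rinv_0_lt_compat; lra|].
        assert (H := Rpower_pos b (- theta)); lra. }
  assert (Hw : norm (P w) <= bound).
  { apply le_epsilon; intros e He.
    assert (H0 := opnorm_ge_0 P).
    assert (He' : 0 < e / (opnorm P + 1)) by (apply Rdiv_lt_0_compat; lra).
    assert (Hloc := locally_ball_norm (V := real_NormedModule V) w (mkposreal _ He')).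
    destruct (Hint _ Hloc) as [Q1 Q2 HQ1 HQ2 HQ].
    apply at_right0_iff in HQ1; destruct HQ1 as [d [Hd HQ1]].
    destruct HQ2 as [M HQ2].
    (* Cut-offs far enough out for the partial integral to be close to [w], and still on both sides
       of [N]. *)
    set (a := Rmin (d / 2) N); set (b := Rmax (M + 1) N).
    assert (Ha : 0 < a) by (apply Rmin_glb_lt; lra).
    assert (Had := Rmin_l (d / 2) N); assert (HaN := Rmin_r (d / 2) N).
    assert (HMb := Rmax_l (M + 1) N); assert (HNb := Rmax_r (M + 1) N).
    fold a in Had, HaN; fold b in HMb, HNb.
    destruct (HQ a b) as [I [HI HIw]]; [apply HQ1; lra | apply HQ2; lra|].
    assert (B := Hpart a b I Ha HaN HNb HI).
    assert (D : norm (minus w I) < e / (opnorm P + 1)) by (rewrite norm_minus_sym; exact HIw).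
    assert (E := norm_le_minus (P w) (P I)); rewrite <- bminus in E.
    assert (F := blin_bound P (minus w I)).
    assert (G : opnorm P * norm (minus w I) <= e).
    { apply Rle_trans with (opnorm P * (e / (opnorm P + 1))); [apply Rmult_le_compat_l; lra|].
      apply Rmult_le_reg_r with (opnorm P + 1); [lra|].
      replace (opnorm P * (e / (opnorm P + 1)) * (opnorm P + 1)) with (opnorm P * e) by (field; lra); nra. }
    lra. }
  rewrite bscal, norm_scalR.
  assert (Hsin : Rabs (sin (PI * theta) / PI) <= 1).
  { assert (Hpi : 1 <= PI) by (assert (H := PI2_1); lra).
    unfold Rdiv; rewrite Rabs_mult, (Rabs_pos_eq (/ PI)) by (apply Rlt_le, Rinv_0_lt_compat; lra).
    apply Rmult_le_reg_r with PI; [lra|].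
    rewrite Rmult_assoc, Rinv_l, Rmult_1_r, Rmult_1_l by lra.
    apply Rle_trans with 1; [|trivial]; apply Rabs_le, SIN_bound. }
  assert (H := norm_ge_0 (P w)); nra.
Qed.

(* Applied to S = -A, P = T and to the dual pair, where P need not be strongly continuous. *)
Record decaying_semigroup {V : CNormed} (S : operator V) (P : R -> blin V V) (K M alpha : R) : Prop := {
  ds_pos : 0 <= K /\ 0 <= M /\ 0 < alpha;
  ds_plus : forall s t x, 0 <= s -> 0 <= t -> P (s + t) x = P s (P t x);
  ds_bounded : forall t x, 0 <= t -> norm (P t x) <= K * norm x;
  ds_commute : forall t x y, 0 <= t -> S x y -> S (P t x) (P t y);
  ds_decay : forall t x y, 0 < t -> S x y -> norm (P t x) <= M * Rpower t (- (1 / alpha)) * norm y;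
  ds_resolvent : forall s u z, 0 < s -> op_shift (RtoC s) S u z -> s * norm u <= K * norm z }.

Section FractionalDecay.
Context {V : CNormed} (S : operator V) (P : R -> blin V V) (K M alpha : R)
  (H : decaying_semigroup S P K M alpha).

Lemma op_pow_commute n t x y : 0 <= t -> op_pow S n x y -> op_pow S n (P t x) (P t y).
Proof.
  intros Ht; revert y; induction n as [|n IH]; intros y; simpl.
  - now intros ->.
  - intros [u [Hu Hy]]; exists (P t u); split; [auto | now apply (ds_commute _ _ _ _ _ H)].
Qed.

Lemma semigroup_halve t x : 0 < t -> P t x = P (t / 2) (P (t / 2) x).
Proof. intros Ht; rewrite <- (ds_plus _ _ _ _ _ H) by lra; f_equal; f_equal; field. Qed.

(** Induction by halving the time: one half pays for the first n powers and, since P commutes with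
    S, the other half decays on the last one. *)
Lemma op_pow_decay n : exists c, 0 <= c /\ forall t x y, 0 < t -> op_pow S n x y ->
  norm (P t x) <= c * Rpower t (- (INR n / alpha)) * norm y.
Proof.
  destruct (ds_pos _ _ _ _ _ H) as [HK [HM Hal]].
  induction n as [|n [c [Hc IH]]].
  - exists K; split; trivial; intros t x y Ht ->; simpl.
    replace (- (0 / alpha)) with 0 by (field; lra).
    rewrite Rpower_O, Rmult_1_r by trivial; apply (ds_bounded _ _ _ _ _ H); lra.
  (* The constant 2^((n+1)/alpha) lost by passing from t to t/2. *)
  - set (q := Rpower (/ 2) (- (INR (Datatypes.S n) / alpha))).
    exists (c * M * q); assert (Hq : 0 < q) by apply Rpower_pos.
    split; [repeat apply Rmult_le_pos; trivial; lra|].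
    intros t x z Ht [y [Hxy Hyz]].
    rewrite semigroup_halve by trivial.
    eapply Rle_trans; [apply (IH (t / 2) _ (P (t / 2) y)); [lra | apply op_pow_commute; trivial; lra]|].
    assert (B := ds_decay _ _ _ _ _ H (t / 2) y z ltac:(lra) Hyz).
    assert (E : Rpower (t / 2) (- (INR n / alpha)) * Rpower (t / 2) (- (1 / alpha))
      = q * Rpower t (- (INR (Datatypes.S n) / alpha))).
    { unfold q; rewrite <- Rpower_plus, Rpower_mult_distr by lra.
      replace (/ 2 * t) with (t / 2) by field; f_equal; rewrite S_INR; field; lra. }
    assert (H0 := Rpower_pos (t / 2) (- (INR n / alpha))).
    apply Rle_trans with (c * Rpower (t / 2) (- (INR n / alpha))
      * (M * Rpower (t / 2) (- (1 / alpha)) * norm z)).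
    + apply Rmult_le_compat_l; trivial; apply Rmult_le_pos; lra.
    + apply Req_le; transitivity (c * M * (Rpower (t / 2) (- (INR n / alpha)) * Rpower (t / 2) (- (1 / alpha))) * norm z);
        [ring | rewrite E; ring].
Qed.

Lemma neg_frac_pow_decay theta : 0 < theta < 1 ->
  exists c, 0 <= c /\ forall t z v, 0 < t -> neg_frac_pow S theta z v ->
    norm (P t v) <= c * Rpower t (- (theta / alpha)) * norm z.
Proof.
  destruct (ds_pos _ _ _ _ _ H) as [HK [HM Hal]]; intros Hth.
  exists (M * (1 + K) / (1 - theta) + K * K / theta).
  assert (Hi1 : 0 < / (1 - theta)) by (apply Rinv_0_lt_compat; lra).
  assert (Hi2 : 0 < / theta) by (apply Rinv_0_lt_compat; lra).
  split.
  { apply Rplus_le_le_0_compat; (apply Rmult_le_pos; [apply Rmult_le_pos; lra | lra]). }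
  intros t z v Ht Hv.
  set (r := Rpower t (- (1 / alpha))); assert (Hr : 0 < r) by apply Rpower_pos.
  assert (Hz := norm_ge_0 z).
  (* The splitting point that balances the two parts: t^(-1/alpha) N^(1-theta) and N^(-theta) both
     equal t^(-theta/alpha). *)
  set (N := Rpower t (1 / alpha)); assert (HN : 0 < N) by apply Rpower_pos.
  eapply Rle_trans.
  { apply (neg_frac_pow_bound S theta (P t) z v (M * r * ((1 + K) * norm z)) (K * (K * norm z)) N);
      trivial.
    - apply Rmult_le_pos; apply Rmult_le_pos; lra.
    - apply Rmult_le_pos; [trivial | apply Rmult_le_pos; trivial].
    (* Here S u = z - s u, and the resolvent estimate gives |S u| <= (1 + K)|z|; the first bound
       uses decay on the domain of S, the second only boundedness of P. *)
    - intros s u Hs Hu; assert (Hb := ds_resolvent _ _ _ _ _ H s u z Hs Hu); split.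
      + eapply Rle_trans; [apply (ds_decay _ _ _ _ _ H t u _ Ht Hu)|].
        apply Rmult_le_compat_l; [apply Rmult_le_pos; lra|].
        eapply Rle_trans; [apply norm_minus_le|]; rewrite scalR_pos by lra; lra.
      + assert (Hp := ds_bounded _ _ _ _ _ H t u ltac:(lra)).
        apply Rle_trans with (s * (K * norm u)); [apply Rmult_le_compat_l; lra|].
        replace (s * (K * norm u)) with (K * (s * norm u)) by ring; now apply Rmult_le_compat_l. }
  assert (E1 : r * Rpower N (1 - theta) = Rpower t (- (theta / alpha))).
  { unfold r, N; rewrite Rpower_mult, <- Rpower_plus; f_equal; field; lra. }
  assert (E2 : Rpower N (- theta) = Rpower t (- (theta / alpha))).
  { unfold N; rewrite Rpower_mult; f_equal; field; lra. }
  rewrite E2, <- E1; apply Req_le; field; lra.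
Qed.

Lemma frac_pow_decay b : 0 <= b ->
  exists c, 0 <= c /\ forall t x y, 0 < t -> frac_pow S b x y ->
    norm (P t x) <= c * Rpower t (- (b / alpha)) * norm y.
Proof.
  destruct (ds_pos _ _ _ _ _ H) as [HK [HM Hal]]; intros Hb.
  destruct (base_fp b) as [Hf0 Hf1].
  set (n := Z.to_nat (Int_part b)).
  (* For b >= 0 the integral part exceeds -1, so [Z.to_nat] truncates nothing. *)
  assert (Hn : INR n = b - frac_part b).
  { unfold n; assert (E := Rplus_Int_part_frac_part b).
    assert (0 <= Int_part b)%Z.
    { assert (-1 < Int_part b)%Z; [apply lt_IZR; lra | lia]. }
    rewrite INR_IZR_INZ, Z2Nat.id by trivial; lra. }
  destruct (op_pow_decay n) as [c1 [Hc1 H1]].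
  destruct (Req_dec (frac_part b) 0) as [E|E].
  - exists c1; split; trivial; intros t x y Ht [[_ Hxy]|[Hlt _]]; [|lra].
    replace b with (INR n) by lra; now apply H1.
  - destruct (neg_frac_pow_decay (frac_part b) ltac:(lra)) as [c2 [Hc2 H2]].
    set (q := Rpower (/ 2) (- (b / alpha))); assert (Hq : 0 < q) by apply Rpower_pos.
    exists (c1 * c2 * q); split; [repeat apply Rmult_le_pos; trivial; lra|].
    (* The intermediate vector [v] is both S^n x and S^(-theta) z; the halved time is shared between
       the two relations. *)
    intros t x z Ht [[Hz _]|[_ [v [Hxv Hv]]]]; [lra|].
    rewrite semigroup_halve by trivial.
    eapply Rle_trans; [apply (H1 (t / 2) _ (P (t / 2) v)); [lra | apply op_pow_commute; trivial; lra]|].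
    assert (B := H2 (t / 2) z v ltac:(lra) Hv).
    assert (E' : Rpower (t / 2) (- (INR n / alpha)) * Rpower (t / 2) (- (frac_part b / alpha))
      = q * Rpower t (- (b / alpha))).
    { unfold q; rewrite <- Rpower_plus, Rpower_mult_distr by lra.
      replace (/ 2 * t) with (t / 2) by field; rewrite Hn; f_equal; field; lra. }
    assert (H0 := Rpower_pos (t / 2) (- (INR n / alpha))).
    apply Rle_trans with (c1 * Rpower (t / 2) (- (INR n / alpha))
      * (c2 * Rpower (t / 2) (- (frac_part b / alpha)) * norm z)).
    + apply Rmult_le_compat_l; trivial; apply Rmult_le_pos; lra.
    + apply Req_le; transitivity (c1 * c2 * (Rpower (t / 2) (- (INR n / alpha)) * Rpower (t / 2) (- (frac_part b / alpha))) * norm z);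
        [ring | rewrite E'; ring].
Qed.

(** Boundedness of P removes the singularity of the rate at t = 0, which would not be integrable for
    large exponents. *)
Lemma frac_pow_orbit_bounded b x : 0 <= b -> dom (frac_pow S b) x ->
  exists c, forall t, 0 <= t -> norm (P t x) <= c * Rpower (1 + t) (- (b / alpha)).
Proof.
  destruct (ds_pos _ _ _ _ _ H) as [HK [HM Hal]]; intros Hb [y Hxy].
  destruct (frac_pow_decay b Hb) as [c [Hc Hdec]].
  assert (Hx := norm_ge_0 x); assert (Hy := norm_ge_0 y).
  set (q := Rpower 2 (b / alpha)); assert (Hq : 0 < q) by apply Rpower_pos.
  assert (Hba : 0 <= b / alpha) by (apply Rmult_le_pos; [trivial | apply Rlt_le, Rinv_0_lt_compat; trivial]).
  (* Used with r = 1 for t <= 1 and with r = t for t > 1. *)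
  assert (Hq2 : forall t, 0 <= t -> forall r, 1 + t <= 2 * r -> 0 < r ->
    Rpower r (- (b / alpha)) <= q * Rpower (1 + t) (- (b / alpha))).
  { intros t Ht r Hr Hr0; unfold q; rewrite !Rpower_Ropp.
    assert (H1 := Rpower_pos r (b / alpha)); assert (H2 := Rpower_pos (1 + t) (b / alpha)).
    apply Rmult_le_reg_l with (Rpower r (b / alpha)); trivial; rewrite Rinv_r by lra.
    apply Rmult_le_reg_r with (Rpower (1 + t) (b / alpha)); trivial.
    replace (Rpower r (b / alpha) * (Rpower 2 (b / alpha) * / Rpower (1 + t) (b / alpha)) * Rpower (1 + t) (b / alpha))
      with (Rpower 2 (b / alpha) * Rpower r (b / alpha)) by (field; lra).
    rewrite Rmult_1_l, Rpower_mult_distr by lra; apply Rle_Rpower_l; lra. }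
  exists (q * (c * norm y + K * norm x)); intros t Ht.
  assert (H0 := Rpower_pos (1 + t) (- (b / alpha))).
  assert (Hcy : 0 <= c * norm y) by now apply Rmult_le_pos.
  assert (HKx : 0 <= K * norm x) by now apply Rmult_le_pos.
  set (p := Rpower (1 + t) (- (b / alpha))) in *.
  replace (q * (c * norm y + K * norm x) * p) with ((c * norm y) * (q * p) + (K * norm x) * (q * p)) by ring.
  assert (Hqp : 0 < q * p) by now apply Rmult_lt_0_compat.
  destruct (Rle_lt_dec t 1) as [Ht1|Ht1].
  - assert (B := ds_bounded _ _ _ _ _ H t x Ht).
    assert (D := Hq2 t Ht 1 ltac:(lra) Rlt_0_1); fold p in D.
    assert (Rpower 1 (- (b / alpha)) = 1) by (unfold Rpower; rewrite ln_1, Rmult_0_r; apply exp_0).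
    assert (0 <= c * norm y * (q * p)) by (apply Rmult_le_pos; lra); nra.
  - assert (B := Hdec t x y ltac:(lra) Hxy).
    assert (D := Hq2 t Ht t ltac:(lra) ltac:(lra)); fold p in D.
    assert (0 <= K * norm x * (q * p)) by (apply Rmult_le_pos; lra).
    assert (c * norm y * Rpower t (- (b / alpha)) <= c * norm y * (q * p)) by (apply Rmult_le_compat_l; trivial).
    lra.
Qed.

End FractionalDecay.

(** * Transposes and the decay properties of a generator and of its adjoint *)

Definition blin_id {X : CNormed} : blin X X := Blin (fun x => x) is_linear_id.

Lemma opnorm_comp {U V W : CNormed} (g : blin V W) (f : blin U V) :
  opnorm (blin_comp g f) <= opnorm g * opnorm f.
Proof.
  assert (Hg := opnorm_ge_0 g); assert (Hf := opnorm_ge_0 f).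
  apply opnorm_le_bound; [now apply Rmult_le_pos|]; intros x.
  rewrite Rmult_assoc; eapply Rle_trans; [apply (blin_bound g)|].
  apply Rmult_le_compat_l; [trivial | apply blin_bound].
Qed.

Lemma transpose_linear {U V : CNormed} (L : blin U V) :
  is_linear (U := dual V) (V := dual U) (fun phi => badjoint L phi).
Proof.
  split.
  - intros phi psi; apply blin_eq; reflexivity.
  - intros k phi; apply blin_eq; reflexivity.
  - exists (opnorm L + 1); assert (H := opnorm_ge_0 L); split; [lra|]; intros phi.
    assert (H' := opnorm_ge_0 phi).
    change (opnorm (blin_comp phi L) <= (opnorm L + 1) * opnorm phi).
    eapply Rle_trans; [apply opnorm_comp | nra].
Qed.

Definition transpose {U V : CNormed} (L : blin U V) : blin (dual V) (dual U) :=
  Blin _ (transpose_linear L).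

Lemma Rmult_le_of_div c x e : 0 < c -> x <= e / c -> c * x <= e.
Proof.
  intros Hc H; apply (Rmult_le_compat_l c) in H; [|lra].
  replace (c * (e / c)) with e in H by (field; lra); exact H.
Qed.

Section DecayInstances.
Context {X : CNormed} (A : operator X) (T : R -> blin X X) (hA : generates A T)
  (L : blin X X) (hL : is_bounded_inverse A L) (K M alpha : R)
  (halpha : 0 < alpha) (hM : 0 <= M)
  (hK : forall t, 0 <= t -> opnorm (T t) <= K)
  (hdecay : forall t, 0 < t -> opnorm (blin_comp (T t) L) <= M * Rpower t (- (1 / alpha))).

Lemma semigroup_bound_nonneg : 0 <= K.
Proof. apply Rle_trans with (2 := hK 0 (Rle_refl 0)), opnorm_ge_0. Qed.

Lemma generator_decaying : decaying_semigroup (op_opp A) T K M alpha.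
Proof.
  assert (HK := semigroup_bound_nonneg).
  split.
  - auto.
  - exact (semigroup_plus A T hA).
  - intros t x Ht; apply blin_bound_le; auto.
  - intros t x y Ht Hxy; unfold op_opp; rewrite <- bopp; now apply (generator_semigroup A T hA).
  - intros t x y Ht Hxy; apply hL in Hxy; rewrite <- Hxy, <- (norm_opp y).
    exact (blin_bound_le (blin_comp (T t) L) (opp y) _ (hdecay t Ht)).
  - intros s u z Hs Hu.
    (* With [Lam] the identity this is the Hille-Yosida estimate. *)
    assert (B := resolvent_bound A T hA blin_id K (K * norm z) s u _ hK Hs Hu).
    assert (E : norm u <= K * norm z / s).
    { apply B; intros t Ht; eapply Rle_trans; [apply (blin_bound_le (T t) _ K); auto|].
      apply Rmult_le_compat_l; trivial; apply Req_le, norm_eq; vmod X. }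
    apply (Rmult_le_compat_l s) in E; [|lra].
    replace (s * (K * norm z / s)) with (K * norm z) in E by (field; lra); exact E.
Qed.

Lemma adjoint_decaying :
  decaying_semigroup (op_opp (adjoint A)) (fun t => transpose (T t)) K M alpha.
Proof.
  assert (HK := semigroup_bound_nonneg).
  assert (Hdense := domain_dense A T hA L hL).
  split.
  - auto.
  - intros s t phi Hs Ht; apply blin_eq; intros x; cbn.
    rewrite (semigroup_plus A T hA), (semigroup_comm A T hA) by trivial; reflexivity.
  - intros t phi Ht; eapply Rle_trans; [apply opnorm_comp|].
    rewrite Rmult_comm; apply Rmult_le_compat_r; [apply opnorm_ge_0 | auto].
  - intros t phi psi Ht H x y Hxy.
    exact (H (T t x) (T t y) (generator_semigroup A T hA t x y Ht Hxy)).
  - intros t phi psi Ht H.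
    assert (Hr : 0 <= M * Rpower t (- (1 / alpha))).
    { apply Rmult_le_pos; [trivial | apply Rlt_le, Rpower_pos]. }
    apply opnorm_le_bound; [apply Rmult_le_pos; [trivial | apply opnorm_ge_0]|]; intros y.
    change (norm (bfun phi (T t y)) <= M * Rpower t (- (1 / alpha)) * opnorm psi * norm y).
    (* Writing T(t)y = A A^-1 T(t)y moves the generator onto the functional and leaves T(t)A^-1
       y. *)
    rewrite (H (L (T t y)) (T t y)) by apply (inverse_generator A L hL).
    rewrite (inverse_semigroup A T hA L hL) by lra.
    eapply Rle_trans; [apply (blin_bound_le _ _ (opnorm psi)), Req_le, opnorm_opp|].
    rewrite (Rmult_comm _ (opnorm psi)), Rmult_assoc.
    apply Rmult_le_compat_l; [apply opnorm_ge_0|].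
    exact (blin_bound_le (blin_comp (T t) L) y _ (hdecay t Ht)).
  - intros s u z Hs Hu.
    assert (Hz := opnorm_ge_0 z).
    assert (Hq : 0 <= K * opnorm z / s).
    { apply Rmult_le_pos; [now apply Rmult_le_pos | apply Rlt_le, Rinv_0_lt_compat; trivial]. }
    assert (E : opnorm u <= K * opnorm z / s).
    { apply opnorm_le_bound; trivial.
      apply (dense_bound A u _ Hq Hdense); intros x [y Hxy].
      replace (K * opnorm z / s * norm x) with (K * opnorm z * norm x / s) by (field; lra).
      apply (resolvent_bound A T hA u K _ s x y hK Hs Hxy); intros t Ht.
      (* The dual resolvent equation tested on the domain reads u(s x - A x) = z(x). So
         [resolvent_bound] with [Lam] = u bounds u there, and density does the rest. *)
      assert (Ez : bfun u (T t (minus (scal (RtoC s : C_AbsRing) x) y)) = bfun z (T t x)).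
      { transitivity (minus (scal (RtoC s : C_AbsRing) (bfun u (T t x) : C_NormedModule)) (bfun u (T t y))).
        { etransitivity; [apply (f_equal (bfun u)), bminus|]; etransitivity; [apply bminus|].
          f_equal; etransitivity; [apply (f_equal (bfun u)), bscal | apply bscal]. }
        rewrite (Hu (T t x) (T t y)) by now apply (generator_semigroup A T hA).
        cbn.
        change (minus (scal (RtoC s : C_AbsRing) (bfun u (T t x) : C_NormedModule))
          (opp (minus (bfun z (T t x) : C_NormedModule)
             (scal (RtoC s : C_AbsRing) (bfun u (T t x) : C_NormedModule)))) = bfun z (T t x)).
        vmod C_NormedModule. }
      rewrite Ez; eapply Rle_trans; [apply blin_bound|].
      rewrite (Rmult_comm K), Rmult_assoc; apply Rmult_le_compat_l; trivial.
      apply blin_bound_le; auto. }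
    apply (Rmult_le_compat_l s) in E; [|lra].
    replace (s * (K * opnorm z / s)) with (K * opnorm z) in E by (field; lra); exact E.
Qed.

End DecayInstances.

(** Banach-Steinhaus for the rescaled family Q(t)/r(t): orbitwise rates become a rate in operator
    norm. *)
Lemma uniform_decay {U V : CNormed} (hU : seq_complete U) (Q : R -> blin U V) (r : R -> R) :
  (forall t, 0 <= t -> 0 < r t) ->
  (forall x, exists c, forall t, 0 <= t -> norm (Q t x) <= c * r t) ->
  exists c, 0 <= c /\ forall t, 0 <= t -> opnorm (Q t) <= c * r t.
Proof.
  intros Hr Hpt.
  destruct (uniform_boundedness hU
    (fun f => exists t, 0 <= t /\ f = scal (RtoC (/ r t) : C_AbsRing) (Q t))) as [c [Hc HM]].
  - intros x; destruct (Hpt x) as [c Hc]; exists c; intros f [t [Ht ->]].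
    assert (H0 := Hr t Ht); assert (Hi := Rinv_0_lt_compat _ H0).
    change (norm (scal (RtoC (/ r t) : C_AbsRing) (Q t x)) <= c).
    rewrite scalR_pos by lra.
    apply Rmult_le_reg_l with (r t); trivial.
    rewrite <- Rmult_assoc, Rinv_r, Rmult_1_l, (Rmult_comm (r t)) by lra; auto.
  - exists c; split; trivial; intros t Ht.
    assert (H0 := Hr t Ht); assert (Hi := Rinv_0_lt_compat _ H0).
    assert (B := HM _ (ex_intro _ t (conj Ht eq_refl))).
    apply opnorm_le_bound; [apply Rmult_le_pos; lra|]; intros x.
    assert (D := blin_bound_le _ x _ B).
    change (norm (scal (RtoC (/ r t) : C_AbsRing) (Q t x)) <= c * norm x) in D.
    rewrite scalR_pos in D by lra.
    apply Rmult_le_reg_l with (/ r t); trivial.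
    replace (/ r t * (c * r t * norm x)) with (c * norm x) by (field; lra); exact D.
Qed.

(** A norming functional for L x reads off |L x| from the transpose. *)
Lemma transpose_bound {U V : CNormed} (L : blin U V) (M : R) :
  0 <= M -> opnorm (transpose L) <= M -> opnorm L <= M.
Proof.
  intros HM H; apply opnorm_le_bound; trivial; intros x.
  destruct (norming_functional (L x)) as [phi [Hphi Hx]].
  apply Rle_trans with (1 := Hx).
  assert (B : opnorm (badjoint L phi) <= M).
  { eapply Rle_trans; [apply (blin_bound_le (transpose L) phi _ H)|].
    rewrite <- (Rmult_1_r M) at 2; now apply Rmult_le_compat_l. }
  exact (blin_bound_le (badjoint L phi) x M B).
Qed.

(** * Duhamel estimate *)

(* F s = P (t - s) (pi (T s z)) has right derivative P (t - s) (D (T s z)). *)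
Lemma duhamel_bound {W V : CNormed} (AA : operator W) (T : R -> blin W W) (hT : generates AA T)
    (A : operator V) (P : R -> blin V V) (hP : generates A P) (K : R)
    (pi : blin W V) (D : W -> V) (g dg : R -> R) (t : R) (z : W) :
  seq_complete W ->
  (forall s, 0 <= s -> opnorm (P s) <= K) ->
  (forall w w', AA w w' -> A (pi w) (minus (pi w') (D w))) ->
  0 <= t -> dom AA z ->
  (forall s, 0 <= s <= t -> is_derive g s (dg s)) ->
  (forall s, 0 <= s < t -> norm (P (t - s) (D (T s z))) <= dg s) ->
  norm (minus (pi (T t z)) (P t (pi z))) <= g t - g 0.
Proof.
  intros hW HK HD Ht [z' Hz] Hg Hdg.
  assert (HK0 : 0 <= K) by (apply Rle_trans with (2 := HK 0 (Rle_refl 0)), opnorm_ge_0).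
  assert (Hpi := opnorm_ge_0 pi).
  destruct (semigroup_bounded_on AA T hT hW t) as [KT HKT].
  set (F s := P (t - s) (pi (T s z))).
  assert (E : minus (pi (T t z)) (P t (pi z)) = minus (F t) (F 0)).
  { unfold F; rewrite Rminus_diag, Rminus_0_r, (semigroup_zero A P hP), (semigroup_zero AA T hT); reflexivity. }
  rewrite E; apply mean_value_right; trivial.
  - intros s Hs e He.
    destruct (semigroup_left_continuous AA T hT KT t z HKT s Hs (e / (2 * ((K + 1) * (K + 1) * (opnorm pi + 1)))))
      as [d1 [Hd1 H1]].
    { apply Rdiv_lt_0_compat; [lra|]; repeat apply Rmult_lt_0_compat; lra. }
    destruct (semigroup_right A P hP (pi (T s z)) (e / (2 * (K + 1)))) as [d2 [Hd2 H2]].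
    { apply Rdiv_lt_0_compat; lra. }
    exists (Rmin d1 d2); split; [now apply Rmin_glb_lt|]; intros r Hr0 Hr.
    assert (Hl := Rmin_l d1 d2); assert (Hr' := Rmin_r d1 d2).
    specialize (H1 r Hr0 ltac:(lra)); specialize (H2 (s - r) ltac:(lra)).
    set (x := pi (T s z)) in *; set (y := pi (T r z)).
    assert (Hxy : norm (minus x y) <= opnorm pi * norm (minus (T s z) (T r z))).
    { unfold x, y; rewrite <- bminus; apply blin_bound. }
    (* Continuity of P is used only at the fixed vector [x]; the moving vector [y] enters through x
       - y, for which boundedness of P is enough. *)
    assert (EF : minus (F s) (F r) = P (t - s) (plus (opp (minus (P (s - r) x) x))
      (plus (minus x y) (minus (P (s - r) (minus x y)) (minus x y)))) ).
    { unfold F; fold x y.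
      replace (t - r) with ((t - s) + (s - r)) by ring.
      rewrite (semigroup_plus A P hP) by lra; rewrite <- bminus; f_equal.
      rewrite (bminus (P (s - r)) x y).
      generalize (P (s - r) x) (P (s - r) y); intros u v; clearbody x y; vmod V. }
    rewrite EF.
    set (n := norm (minus (T s z) (T r z))) in *.
    set (m := norm (minus (P (s - r) x) x)) in *.
    eapply Rle_trans; [apply (blin_bound_le _ _ K), HK; lra|].
    assert (B1 : norm (plus (opp (minus (P (s - r) x) x))
      (plus (minus x y) (minus (P (s - r) (minus x y)) (minus x y)))) <= m + K * (opnorm pi * n) + 2 * (opnorm pi * n)).
    { eapply Rle_trans; [apply norm_triangle|].
      assert (C : K * norm (minus x y) <= K * (opnorm pi * n)) by now apply Rmult_le_compat_l.
      apply Rle_trans with (m + (norm (minus x y) + (K * norm (minus x y) + norm (minus x y)))); [|lra].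
      apply Rplus_le_compat; [apply Req_le, norm_opp|].
      eapply Rle_trans; [apply norm_triangle|]; apply Rplus_le_compat_l.
      eapply Rle_trans; [apply norm_minus_le|]; apply Rplus_le_compat_r.
      apply blin_bound_le, HK; lra. }
    apply Rle_trans with (K * (m + K * (opnorm pi * n) + 2 * (opnorm pi * n))).
    { now apply Rmult_le_compat_l. }
    assert (Q1 := Rmult_le_of_div (2 * (K + 1)) m e ltac:(lra) (Rlt_le _ _ H2)).
    assert (Q2 := Rmult_le_of_div (2 * ((K + 1) * (K + 1) * (opnorm pi + 1))) n e
      ltac:(repeat apply Rmult_lt_0_compat; lra) H1).
    assert (Hm : 0 <= m) by apply norm_ge_0; assert (Hn : 0 <= n) by apply norm_ge_0.
    assert (Q3 : K * (K + 2) * opnorm pi * n <= (K + 1) * (K + 1) * (opnorm pi + 1) * n).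
    { apply Rmult_le_compat_r; trivial.
      assert (0 <= (K + 1) * (K + 1)) by (apply Rmult_le_pos; lra); nra. }
    lra.
  - intros s Hs; apply (ex_derive_continuous g); exists (dg s); now apply Hg.
  - intros s Hs e He.
    set (w := T s z); set (w' := T s z').
    assert (Hw : AA w w') by (apply (generator_semigroup AA T hT); [lra | trivial]).
    (* Three error terms of size at most [e1 * h], each multiplied by at most [K], use up 3/4 of e
       h; the derivative of [g] takes the last quarter. *)
    set (e1 := e / (4 * (K + 1))).
    assert (He1 : 0 < e1) by (apply Rdiv_lt_0_compat; lra).
    destruct (proj1 (generator_increment AA T hT w w') Hw (e1 / (opnorm pi + 1))) as [d1 [Hd1 H1]].
    { apply Rdiv_lt_0_compat; lra. }
    destruct (proj1 (generator_increment A P hP _ _) (HD w w' Hw) e1 He1) as [d2 [Hd2 H2]].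
    destruct (semigroup_right A P hP (D w) e1 He1) as [d3 [Hd3 H3]].
    destruct (proj1 (is_derive_Reals _ _ _) (Hg s ltac:(lra)) (e / 4) ltac:(lra)) as [d4 H4].
    set (d := Rmin (Rmin d1 d2) (Rmin d3 d4)).
    assert (L1 := Rmin_l (Rmin d1 d2) (Rmin d3 d4)); assert (L2 := Rmin_r (Rmin d1 d2) (Rmin d3 d4)).
    assert (L3 := Rmin_l d1 d2); assert (L4 := Rmin_r d1 d2).
    assert (L5 := Rmin_l d3 d4); assert (L6 := Rmin_r d3 d4).
    exists d; split.
    { repeat apply Rmin_glb_lt; trivial; apply cond_pos. }
    intros h Hh Hsh; fold d in L1, L2.
    specialize (H1 h ltac:(lra)); specialize (H2 h ltac:(lra)); specialize (H3 h ltac:(lra)).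
    assert (H4' : h * dg s <= g (s + h) - g s + e / 4 * h).
    { specialize (H4 h ltac:(lra) ltac:(rewrite Rabs_pos_eq; lra)).
      apply Rabs_def2 in H4; destruct H4 as [_ H4].
      apply (Rmult_lt_compat_l h) in H4; [|lra].
      replace (h * ((g (s + h) - g s) / h - dg s)) with (g (s + h) - g s - h * dg s) in H4 by (field; lra).
      lra. }
    set (o1 := minus (T h w) (plus w (scal (RtoC h : C_AbsRing) w'))) in *.
    set (o2 := minus (P h (pi w)) (plus (pi w) (scal (RtoC h : C_AbsRing) (minus (pi w') (D w))))) in *.
    set (o3 := minus (P h (D w)) (D w)) in *.
    (* To first order [pi w'] cancels and h D w remains; [o3] accounts for exchanging P(t-s-h) D w
       with P(t-s) D w. *)
    assert (EF : minus (F (s + h)) (F s) = plus (scal (RtoC h : C_AbsRing) (P (t - s) (D w)))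
      (P (t - (s + h)) (minus (minus (pi o1) o2) (scal (RtoC h : C_AbsRing) o3)))).
    { unfold F; rewrite (Rplus_comm s h), (semigroup_plus AA T hT) by lra; fold w.
      replace (t - s) with ((t - (h + s)) + h) by ring.
      rewrite !(semigroup_plus A P hP) by lra.
      etransitivity; [symmetry; apply bminus|].
      etransitivity; [|exact (f_equal2 plus (bscal _ (RtoC h : C_AbsRing) _) eq_refl)].
      etransitivity; [|apply bplus]; f_equal.
      assert (Eo : pi o1 = minus (pi (T h w)) (plus (pi w) (scal (RtoC h : C_AbsRing) (pi w')))).
      { unfold o1; etransitivity; [apply bminus|]; f_equal.
        etransitivity; [apply bplus|]; f_equal; apply bscal. }
      rewrite Eo; unfold o2, o3; vmod V. }
    rewrite EF.
    eapply Rle_trans; [apply norm_triangle|].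
    rewrite scalR_pos by lra.
    assert (B0 : h * norm (P (t - s) (D w)) <= h * dg s) by (apply Rmult_le_compat_l; [lra | apply Hdg; lra]).
    assert (B1 : norm (pi o1) <= e1 * h).
    { eapply Rle_trans; [apply blin_bound|].
      apply Rle_trans with (opnorm pi * (e1 / (opnorm pi + 1) * h)); [now apply Rmult_le_compat_l|].
      apply Rmult_le_reg_r with (opnorm pi + 1); [lra|].
      replace (opnorm pi * (e1 / (opnorm pi + 1) * h) * (opnorm pi + 1)) with (opnorm pi * (e1 * h)) by (field; lra).
      assert (0 < e1 * h) by (apply Rmult_lt_0_compat; lra); nra. }
    assert (B2 : norm (minus (minus (pi o1) o2) (scal (RtoC h : C_AbsRing) o3)) <= 3 * e1 * h).
    { eapply Rle_trans; [apply norm_minus_le|]; rewrite scalR_pos by lra.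
      assert (C1 := norm_minus_le (pi o1) o2).
      assert (h * norm o3 <= h * e1) by (apply Rmult_le_compat_l; lra); lra. }
    assert (B3 := blin_bound_le (P (t - (s + h))) (minus (minus (pi o1) o2) (scal (RtoC h : C_AbsRing) o3))
                    K (HK (t - (s + h)) ltac:(lra))).
    apply (Rmult_le_compat_l K) in B2; trivial.
    assert (B4 : K * (3 * e1 * h) <= 3 / 4 * e * h).
    { apply Rle_trans with ((K + 1) * (3 * e1 * h)).
      - apply Rmult_le_compat_r; [apply Rmult_le_pos; lra | lra].
      - unfold e1; apply Req_le; field; lra. }
    lra.
Qed.

(** * Power estimates and the convolution kernel *)

Lemma Rpower_antitone p q a : 0 < p -> p <= q -> 0 <= a -> Rpower q (- a) <= Rpower p (- a).
Proof.
  intros Hp Hpq Ha; rewrite !Rpower_Ropp; apply Rinv_le_contravar; [apply Rpower_pos|].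
  apply Rle_Rpower_l; lra.
Qed.

Lemma Rpower_vanishes p e : 0 < p -> 0 < e -> exists t0, 0 < t0 /\ forall t, t0 < t -> Rpower t (- p) < e.
Proof.
  intros Hp He; exists (Rpower e (- (1 / p))); split; [apply Rpower_pos|]; intros t Ht.
  assert (H0 := Rpower_pos e (- (1 / p))).
  rewrite Rpower_Ropp.
  assert (E : e = / Rpower (Rpower e (- (1 / p))) p).
  { rewrite Rpower_mult, <- Rpower_Ropp.
    replace (- (- (1 / p) * p)) with 1 by (field; lra); symmetry; now apply Rpower_1. }
  rewrite E; apply Rinv_lt_contravar.
  - apply Rmult_lt_0_compat; apply Rpower_pos.
  - apply Rlt_Rpower_l; lra.
Qed.

(** The product is at most the power -(a + b) of the smaller base. This merges two separately
    non-integrable rates into one exponent. *)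
Lemma Rpower_mul_le p q a b : 0 < p -> 0 < q -> 0 <= a -> 0 <= b ->
  Rpower p (- a) * Rpower q (- b) <= Rpower p (- (a + b)) + Rpower q (- (a + b)).
Proof.
  intros Hp Hq Ha Hb; rewrite Ropp_plus_distr, !Rpower_plus.
  assert (P1 := Rpower_pos p (- a)); assert (P2 := Rpower_pos p (- b)).
  assert (P3 := Rpower_pos q (- a)); assert (P4 := Rpower_pos q (- b)).
  destruct (Rle_lt_dec p q) as [H|H].
  - assert (Rpower q (- b) <= Rpower p (- b)) by now apply Rpower_antitone.
    assert (0 < Rpower q (- a) * Rpower q (- b)) by now apply Rmult_lt_0_compat.
    assert (Rpower p (- a) * Rpower q (- b) <= Rpower p (- a) * Rpower p (- b))
      by (apply Rmult_le_compat_l; lra); lra.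
  - assert (Rpower p (- a) <= Rpower q (- a)) by (apply Rpower_antitone; lra).
    assert (0 < Rpower p (- a) * Rpower p (- b)) by now apply Rmult_lt_0_compat.
    assert (Rpower p (- a) * Rpower q (- b) <= Rpower q (- a) * Rpower q (- b))
      by (apply Rmult_le_compat_r; lra); lra.
Qed.

(* An antiderivative in s of the kernel (1 + t - s)^-c + (1 + s)^-c. *)
Definition kernel_primitive (c t s : R) : R :=
  (Rpower (1 + t - s) (1 - c) - Rpower (1 + s) (1 - c)) / (c - 1).

Lemma kernel_primitive_derive c t s : 1 < c -> 0 <= s <= t ->
  is_derive (kernel_primitive c t) s (Rpower (1 + t - s) (- c) + Rpower (1 + s) (- c)).
Proof.
  intros Hc Hs; unfold kernel_primitive.
  assert (D1 : is_derive (fun u => Rpower (1 + t - u) (1 - c)) s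
    (- 1 * ((1 - c) * Rpower (1 + t - s) (1 - c - 1)))).
  { apply (is_derive_comp (fun v => Rpower v (1 - c)) (fun u => 1 + t - u)).
    - apply is_derive_Reals, derivable_pt_lim_power; lra.
    - auto_derive; trivial; ring. }
  assert (D2 : is_derive (fun u => Rpower (1 + u) (1 - c)) s
    (1 * ((1 - c) * Rpower (1 + s) (1 - c - 1)))).
  { apply (is_derive_comp (fun v => Rpower v (1 - c)) (fun u => 1 + u)).
    - apply is_derive_Reals, derivable_pt_lim_power; lra.
    - auto_derive; trivial; ring. }
  assert (D3 := is_derive_scal _ _ (/ (c - 1)) _ (is_derive_minus _ _ _ _ _ D1 D2)).
  replace (Rpower (1 + t - s) (- c) + Rpower (1 + s) (- c)) with
    (/ (c - 1) * minus (- 1 * ((1 - c) * Rpower (1 + t - s) (1 - c - 1)))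
                       (1 * ((1 - c) * Rpower (1 + s) (1 - c - 1)))).
  - apply is_derive_ext with (2 := D3); intros u.
    exact (Rmult_comm (/ (c - 1)) (Rpower (1 + t - u) (1 - c) - Rpower (1 + u) (1 - c))).
  - replace (1 - c - 1) with (- c) by ring.
    unfold minus, plus, opp; simpl; field; lra.
Qed.

(** Both kernel terms integrate to at most 1/(c - 1), the integral of (1 + s)^-c over the half-line;
    hence a bound uniform in t. *)
Lemma kernel_primitive_bound c t : 1 < c -> 0 <= t ->
  kernel_primitive c t t - kernel_primitive c t 0 <= 2 / (c - 1).
Proof.
  intros Hc Ht; unfold kernel_primitive.
  replace (1 + t - t) with 1 by ring; replace (1 + t - 0) with (1 + t) by ring; rewrite Rplus_0_r.
  assert (E : Rpower 1 (1 - c) = 1) by (unfold Rpower; rewrite ln_1, Rmult_0_r; apply exp_0).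
  rewrite E; assert (H := Rpower_pos (1 + t) (1 - c)).
  replace ((1 - Rpower (1 + t) (1 - c)) / (c - 1) - (Rpower (1 + t) (1 - c) - 1) / (c - 1))
    with ((2 - 2 * Rpower (1 + t) (1 - c)) / (c - 1)) by (field; lra).
  apply Rmult_le_compat_r; [apply Rlt_le, Rinv_0_lt_compat; lra | lra].
Qed.

(** * The inverse of the operator matrix, and rates for the input and output operators *)

Definition blin_fst {U V : CNormed} : blin (prod_NormedModule C_AbsRing U V) U :=
  Blin (fun z => fst z) is_linear_fst.
Definition blin_snd {U V : CNormed} : blin (prod_NormedModule C_AbsRing U V) V :=
  Blin (fun z => snd z) is_linear_snd.
Definition blin_pair {W U V : CNormed} (f : blin W U) (g : blin W V) :
  blin W (prod_NormedModule C_AbsRing U V) :=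
  Blin (fun w => (f w, g w)) (is_linear_prod _ _ (blin_linear f) (blin_linear g)).

Lemma norm_prod_le {U V : CNormed} (z : prod_NormedModule C_AbsRing U V) (m : R) :
  norm (fst z) <= m -> norm (snd z) <= m -> norm z <= 2 * m.
Proof.
  destruct z as [x y]; simpl; intros Hx Hy.
  assert (H := proj2 (norm_prod x y)).
  assert (Hsqrt := sqrt2_le_2).
  assert (S2 := sqrt_pos 2); assert (Hm := Rmax_lub _ _ _ Hx Hy).
  assert (Hm0 := Rle_trans _ _ _ (norm_ge_0 x) Hx).
  apply Rle_trans with (1 := H).
  apply Rle_trans with (sqrt 2 * m); [now apply Rmult_le_compat_l | now apply Rmult_le_compat_r].
Qed.

(** Back substitution: x2 = A2^-1 y2, then x1 = A1^-1 (y1 - P x2). *)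
Definition block_inverse {X1 X2 : CNormed} (L1 : blin X1 X1) (P : blin X2 X1) (L2 : blin X2 X2) :
  blin (prod_NormedModule C_AbsRing X1 X2) (prod_NormedModule C_AbsRing X1 X2) :=
  blin_pair
    (blin_comp L1 (minus blin_fst (blin_comp P (blin_comp L2 blin_snd))
       : blin (prod_NormedModule C_AbsRing X1 X2) X1))
    (blin_comp L2 blin_snd).

Lemma block_inverse_correct {X1 X2 : CNormed} (A1 : operator X1) (P : blin X2 X1) (A2 : operator X2)
    (L1 : blin X1 X1) (L2 : blin X2 X2) :
  is_bounded_inverse A1 L1 -> is_bounded_inverse A2 L2 ->
  is_bounded_inverse (block_op A1 P A2) (block_inverse L1 P L2).
Proof.
  intros H1 H2 [x1 x2] [y1 y2]; unfold block_op; simpl; split.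
  - intros [z [Hz [-> Hy]]]; apply H1 in Hz; apply H2 in Hy.
    rewrite Hy, <- Hz; f_equal.
    change (L1 (minus (plus z (P x2)) (P x2)) = L1 z); f_equal; vmod X1.
  - intros E; injection E; intros E2 E1.
    exists (minus y1 (P x2)); split; [|split].
    + apply H1; rewrite <- E1, <- E2; reflexivity.
    + vmod X1.
    + now apply H2.
Qed.

Lemma polynomially_stable_bounds {X : CNormed} (A : operator X) (T : R -> blin X X) (alpha : R) :
  polynomially_stable A T alpha ->
  exists L K M, is_bounded_inverse A L /\ 0 <= M /\
    (forall t, 0 <= t -> opnorm (T t) <= K) /\
    (forall t, 0 < t -> opnorm (blin_comp (T t) L) <= M * Rpower t (- (1 / alpha))).
Proof.
  intros [[K HK] [_ [L [HL [M [HM Hd]]]]]].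
  exists L, K, M; repeat split; try apply HL; trivial; lra.
Qed.

Lemma input_decay {X Y : CNormed} (A : operator X) (T : R -> blin X X) (alpha beta : R)
    (B : blin Y X) :
  seq_complete Y -> generates A T -> 0 < alpha -> polynomially_stable A T alpha -> 0 <= beta ->
  (forall y, dom (frac_pow (op_opp A) beta) (B y)) ->
  exists k, 0 <= k /\ forall t, 0 <= t -> opnorm (blin_comp (T t) B) <= k * Rpower (1 + t) (- (beta / alpha)).
Proof.
  intros hY hA Hal hT Hb HB.
  destruct (polynomially_stable_bounds A T alpha hT) as [L [K [M [HL [HM [HK Hd]]]]]].
  apply uniform_decay; trivial.
  - intros; apply Rpower_pos.
  - intros y; exact (frac_pow_orbit_bounded _ _ _ _ _
      (generator_decaying A T hA L HL K M alpha Hal HM HK Hd) beta (B y) Hb (HB y)).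
Qed.

(** The transpose of C T(t) is the dual semigroup applied after the transpose of C, whose range lies
    in the fractional domain; so the argument for an input operator runs on the dual side. *)
Lemma output_decay {X Y : CNormed} (A : operator X) (T : R -> blin X X) (alpha gamma : R)
    (Cop : blin X Y) :
  generates A T -> 0 < alpha -> polynomially_stable A T alpha -> 0 <= gamma ->
  (forall phi : dual Y, dom (frac_pow (op_opp (adjoint A)) gamma) (badjoint Cop phi)) ->
  exists k, 0 <= k /\ forall t, 0 <= t -> opnorm (blin_comp Cop (T t)) <= k * Rpower (1 + t) (- (gamma / alpha)).
Proof.
  intros hA Hal hT Hg HC.
  destruct (polynomially_stable_bounds A T alpha hT) as [L [K [M [HL [HM [HK Hd]]]]]].
  destruct (uniform_decay (seq_complete_dual Y) (fun t => transpose (blin_comp Cop (T t)))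
    (fun t => Rpower (1 + t) (- (gamma / alpha)))) as [k [Hk H]].
  - intros; apply Rpower_pos.
  - intros phi.
    destruct (frac_pow_orbit_bounded _ _ _ _ _
      (adjoint_decaying A T hA L HL K M alpha Hal HM HK Hd) gamma (badjoint Cop phi) Hg (HC phi)) as [c Hc].
    exists c; intros t Ht; eapply Rle_trans; [|exact (Hc t Ht)].
    apply Req_le, norm_eq, blin_eq; reflexivity.
  - exists k; split; trivial; intros t Ht; apply transpose_bound; auto.
    apply Rmult_le_pos; [trivial | apply Rlt_le, Rpower_pos].
Qed.

(** * The triangular semigroup *)

Section BlockSemigroup.
Context {X1 X2 Y : CNormed} (hX1 : seq_complete X1) (hX2 : seq_complete X2)
  (A1 : operator X1) (A2 : operator X2) (T1 : R -> blin X1 X1) (T2 : R -> blin X2 X2)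
  (hA1 : generates A1 T1) (hA2 : generates A2 T2)
  (L1 : blin X1 X1) (L2 : blin X2 X2)
  (hL1 : is_bounded_inverse A1 L1) (hL2 : is_bounded_inverse A2 L2)
  (B : blin Y X1) (Cop : blin X2 Y)
  (T : R -> blin (prod_NormedModule C_AbsRing X1 X2) (prod_NormedModule C_AbsRing X1 X2))
  (hT : generates (block_op A1 (blin_comp B Cop) A2) T)
  (K1 K2 : R)
  (hK1 : forall t, 0 <= t -> opnorm (T1 t) <= K1) (hK2 : forall t, 0 <= t -> opnorm (T2 t) <= K2).

Let AA := block_op A1 (blin_comp B Cop) A2.
Let LL := block_inverse L1 (blin_comp B Cop) L2.

(** Uniqueness for the Cauchy problem as the Duhamel estimate with zero coupling and zero
    majorant. *)
Lemma block_snd_domain t z : 0 <= t -> dom AA z -> snd (T t z) = T2 t (snd z).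
Proof.
  intros Ht Hz.
  apply norm_minus_le_0; rewrite <- (Rminus_diag 0).
  apply (duhamel_bound AA T hT A2 T2 hA2 K2 blin_snd (fun _ => zero) (fun _ => 0) (fun _ => 0) t z);
    trivial.
  - now apply seq_complete_prod.
  - intros w w' [v [_ [_ Hv]]].
    change (A2 (snd w) (minus (snd w') zero)).
    replace (minus (snd w') zero) with (snd w') by vmod X2; exact Hv.
  - intros s Hs; apply (is_derive_const (V := R_NormedModule)).
  - intros s Hs; rewrite bzero; apply Req_le, norm_zero.
Qed.

Context (a b k1 k2 : R) (ha : 0 <= a) (hb : 0 <= b) (hab : 1 < a + b)
  (hk1 : 0 <= k1) (hk2 : 0 <= k2)
  (hB : forall t, 0 <= t -> opnorm (blin_comp (T1 t) B) <= k1 * Rpower (1 + t) (- a))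
  (hC : forall t, 0 <= t -> opnorm (blin_comp Cop (T2 t)) <= k2 * Rpower (1 + t) (- b)).

(** Bound on the corner of T(t), uniform in t: the two rate constants times the bound on the kernel
    integral. *)
Let kappa := k1 * k2 * (2 / (a + b - 1)).

Lemma kappa_nonneg : 0 <= kappa.
Proof.
  apply Rmult_le_pos; [now apply Rmult_le_pos|].
  apply Rmult_le_pos; [lra | apply Rlt_le, Rinv_0_lt_compat; lra].
Qed.

Lemma block_fst_domain t z : 0 <= t -> dom AA z ->
  norm (minus (fst (T t z)) (T1 t (fst z))) <= kappa * norm (snd z).
Proof.
  intros Ht Hz; assert (Hn := norm_ge_0 (snd z)).
  set (q := k1 * k2 * norm (snd z)).
  assert (Hq : 0 <= q) by (apply Rmult_le_pos; [now apply Rmult_le_pos | trivial]).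
  set (c := a + b).
  apply Rle_trans with (q * kernel_primitive c t t - q * kernel_primitive c t 0).
  - apply (duhamel_bound AA T hT A1 T1 hA1 K1 blin_fst (fun w => blin_comp B Cop (snd w))
      (fun s => q * kernel_primitive c t s)
      (fun s => q * (Rpower (1 + t - s) (- c) + Rpower (1 + s) (- c))) t z); trivial.
    + now apply seq_complete_prod.
    + intros w w' [v [Hv [E _]]].
      change (blin_fst w') with (fst w'); rewrite E.
      replace (minus (plus v (blin_comp B Cop (snd w))) (blin_comp B Cop (snd w))) with v by vmod X1.
      exact Hv.
    + intros s Hs; apply (is_derive_scal (kernel_primitive c t)).
      now apply kernel_primitive_derive.
    (* The second component evolves on its own, so the coupling term is T1(t-s)B applied to C T2(s)
       z2 and the two rates multiply. *)
    + intros s Hs; rewrite block_snd_domain by (trivial; lra).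
      change (norm (blin_comp (T1 (t - s)) B (blin_comp Cop (T2 s) (snd z)))
        <= q * (Rpower (1 + t - s) (- c) + Rpower (1 + s) (- c))).
      eapply Rle_trans; [apply (blin_bound_le _ _ _ (hB (t - s) ltac:(lra)))|].
      assert (P1 := Rpower_pos (1 + (t - s)) (- a)); assert (P2 := Rpower_pos (1 + s) (- b)).
      eapply Rle_trans.
      { apply Rmult_le_compat_l; [apply Rmult_le_pos; lra|].
        apply (blin_bound_le _ _ _ (hC s ltac:(lra))). }
      replace (1 + t - s) with (1 + (t - s)) by ring.
      assert (H := Rpower_mul_le (1 + (t - s)) (1 + s) a b ltac:(lra) ltac:(lra) ha hb).
      apply (Rmult_le_compat_l q) in H; trivial.
      eapply Rle_trans; [|exact H]; apply Req_le; unfold q; ring.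
  - assert (H := kernel_primitive_bound c t hab Ht).
    apply (Rmult_le_compat_l q) in H; trivial.
    unfold kappa; fold c; unfold q in *; lra.
Qed.

Lemma block_domain_dense z e : 0 < e -> exists z', dom AA z' /\ norm (minus z z') <= e.
Proof.
  exact (domain_dense AA T hT LL (block_inverse_correct A1 _ A2 L1 L2 hL1 hL2) z e).
Qed.

(** The difference of both sides is a bounded operator vanishing on the dense domain. *)
Lemma block_snd t z : 0 <= t -> snd (T t z) = T2 t (snd z).
Proof.
  intros Ht.
  set (f := minus (blin_comp blin_snd (T t)) (blin_comp (T2 t) blin_snd)
    : blin (prod_NormedModule C_AbsRing X1 X2) X2).
  assert (Hf : forall z, norm (f z) <= 0 * norm z).
  { apply (dense_bound AA f 0 (Rle_refl 0) block_domain_dense); intros x Hx.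
    rewrite Rmult_0_l; change (norm (minus (snd (T t x)) (T2 t (snd x))) <= 0).
    rewrite (block_snd_domain t x Ht Hx), norm_minus_self; lra. }
  specialize (Hf z); rewrite Rmult_0_l in Hf.
  exact (norm_minus_le_0 _ _ Hf).
Qed.

Lemma block_bounded : exists K, 0 <= K /\ forall t z, 0 <= t -> norm (T t z) <= K * norm z.
Proof.
  assert (Hk := kappa_nonneg).
  assert (H1 : 0 <= K1) by exact (semigroup_bound_nonneg T1 K1 hK1).
  assert (H2 : 0 <= K2) by exact (semigroup_bound_nonneg T2 K2 hK2).
  exists (2 * (K1 + kappa + K2)); split; [lra|]; intros t z Ht.
  apply (dense_bound AA (T t)); [lra | exact block_domain_dense|]; clear z; intros z Hz.
  assert (N1 := norm_le_prod_norm_1 z); assert (N2 := norm_le_prod_norm_2 z).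
  assert (Hz0 := norm_ge_0 z).
  rewrite Rmult_assoc; apply norm_prod_le.
  - assert (E1 := norm_le_minus (fst (T t z)) (T1 t (fst z))).
    assert (E2 := block_fst_domain t z Ht Hz).
    assert (E3 := blin_bound_le (T1 t) (fst z) K1 (hK1 t Ht)).
    apply (Rmult_le_compat_l kappa) in N2; trivial; apply (Rmult_le_compat_l K1) in N1; trivial.
    assert (0 <= K2 * norm z) by now apply Rmult_le_pos.
    apply Rle_trans with (1 := E1).
    apply Rle_trans with (kappa * norm z + K1 * norm z); [|lra].
    apply Rplus_le_compat.
    + apply Rle_trans with (1 := E2); exact N2.
    + apply Rle_trans with (1 := E3); exact N1.
  - rewrite block_snd by trivial.
    apply Rle_trans with (K2 * norm z).
    + eapply Rle_trans; [apply (blin_bound_le (T2 t) (snd z) K2 (hK2 t Ht))|].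
      now apply Rmult_le_compat_l.
    + apply Rmult_le_compat_r; lra.
Qed.

Context (M1 M2 alpha1 alpha2 : R) (hM1 : 0 <= M1) (hM2 : 0 <= M2)
  (hd1 : forall t, 0 < t -> opnorm (blin_comp (T1 t) L1) <= M1 * Rpower t (- (1 / alpha1)))
  (hd2 : forall t, 0 < t -> opnorm (blin_comp (T2 t) L2) <= M2 * Rpower t (- (1 / alpha2))).

(* T(2 s) A^-1 = T(s) A^-1 T(s): the second component of A^-1 T(s) z is T2(s) A2^-1 z2 and its
   first component is in the range of A1^-1, so both halves decay under T(s). *)
Lemma block_decay : exists c, 0 <= c /\ forall t, 0 < t ->
  opnorm (blin_comp (T t) LL) <= c * (Rpower (t / 2) (- (1 / alpha1)) + Rpower (t / 2) (- (1 / alpha2))).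
Proof.
  assert (Hk := kappa_nonneg).
  assert (H2 : 0 <= K2) by exact (semigroup_bound_nonneg T2 K2 hK2).
  destruct block_bounded as [KT [HKT HT]].
  set (BC := blin_comp B Cop).
  assert (HBC := opnorm_ge_0 BC); assert (HL2 := opnorm_ge_0 L2).
  set (c1 := M1 * (KT + opnorm BC * opnorm L2 * KT)).
  set (c2 := (K2 + kappa) * M2).
  assert (Hc1 : 0 <= c1).
  { apply Rmult_le_pos; trivial; apply Rplus_le_le_0_compat; trivial.
    repeat apply Rmult_le_pos; trivial. }
  assert (Hc2 : 0 <= c2) by (apply Rmult_le_pos; lra).
  exists (2 * (c1 + c2)); split; [lra|]; intros t Ht.
  set (s := t / 2); assert (Hs : 0 < s) by (unfold s; lra).
  set (r1 := Rpower s (- (1 / alpha1))); set (r2 := Rpower s (- (1 / alpha2))).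
  assert (Hr1 : 0 < r1) by apply Rpower_pos; assert (Hr2 : 0 < r2) by apply Rpower_pos.
  apply opnorm_le_bound; [apply Rmult_le_pos; lra|]; intros z.
  assert (Hz := norm_ge_0 z).
  change (norm (T t (LL z)) <= 2 * (c1 + c2) * (r1 + r2) * norm z).
  replace t with (s + s) by (unfold s; field).
  assert (hLL : is_bounded_inverse AA LL) by now apply block_inverse_correct.
  rewrite (semigroup_plus AA T hT), <- (inverse_semigroup AA T hT LL hLL) by lra.
  set (w := T s z); set (v := LL w).
  assert (Hv : dom AA v) by (exists w; apply (inverse_generator AA LL hLL)).
  assert (Hw : norm w <= KT * norm z) by (apply HT; lra).
  assert (N1 := norm_le_prod_norm_1 w); assert (N2 := norm_le_prod_norm_2 w).
  assert (Ev2 : snd v = T2 s (L2 (snd z))).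
  { change (L2 (snd (T s z)) = T2 s (L2 (snd z))).
    rewrite block_snd by lra; apply (inverse_semigroup A2 T2 hA2 L2 hL2); lra. }
  assert (Hv2 : norm (snd v) <= M2 * r2 * norm z).
  { rewrite Ev2; eapply Rle_trans; [exact (blin_bound_le _ (snd z) _ (hd2 s Hs))|].
    apply Rmult_le_compat_l; [apply Rmult_le_pos; lra | apply norm_le_prod_norm_2]. }
  assert (Hv1 : norm (T1 s (fst v)) <= c1 * r1 * norm z).
  { change (norm (blin_comp (T1 s) L1 (minus (fst w) (BC (L2 (snd w))))) <= c1 * r1 * norm z).
    eapply Rle_trans; [exact (blin_bound_le _ _ _ (hd1 s Hs))|].
    assert (D : norm (minus (fst w) (BC (L2 (snd w)))) <= (KT + opnorm BC * opnorm L2 * KT) * norm z).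
    { eapply Rle_trans; [apply norm_minus_le|].
      rewrite Rmult_plus_distr_r; apply Rplus_le_compat.
      - apply Rle_trans with (1 := N1); exact Hw.
      - eapply Rle_trans; [apply blin_bound|]; rewrite !Rmult_assoc; apply Rmult_le_compat_l; trivial.
        eapply Rle_trans; [apply blin_bound|]; apply Rmult_le_compat_l; trivial.
        apply Rle_trans with (1 := N2); exact Hw. }
    apply (Rmult_le_compat_l (M1 * r1)) in D; [|apply Rmult_le_pos; lra].
    eapply Rle_trans; [exact D|]; apply Req_le; unfold c1; ring. }
  assert (Q1 : 0 <= c1 * r1 * norm z) by (apply Rmult_le_pos; [apply Rmult_le_pos; lra | trivial]).
  assert (Q2 : 0 <= c2 * r2 * norm z) by (apply Rmult_le_pos; [apply Rmult_le_pos; lra | trivial]).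
  assert (Q3 : 0 <= c1 * r2 * norm z) by (apply Rmult_le_pos; [apply Rmult_le_pos; lra | trivial]).
  assert (Q4 : 0 <= c2 * r1 * norm z) by (apply Rmult_le_pos; [apply Rmult_le_pos; lra | trivial]).
  assert (Q5 : 0 <= M2 * r2 * norm z) by (apply Rmult_le_pos; [apply Rmult_le_pos; lra | trivial]).
  apply Rle_trans with (2 * (c1 * r1 * norm z + c2 * r2 * norm z)); [|lra].
  apply norm_prod_le.
  (* The corner acts only on the second component of [v], which is already small. *)
  - eapply Rle_trans; [apply (norm_le_minus _ (T1 s (fst v)))|].
    rewrite Rplus_comm; apply Rplus_le_compat; trivial.
    eapply Rle_trans; [apply (block_fst_domain s v ltac:(lra) Hv)|].
    apply Rle_trans with (kappa * (M2 * r2 * norm z)); [now apply Rmult_le_compat_l|].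
    apply Rle_trans with ((K2 + kappa) * (M2 * r2 * norm z)); [apply Rmult_le_compat_r; lra|].
    apply Req_le; unfold c2; ring.
  - rewrite block_snd by lra.
    apply Rle_trans with (K2 * (M2 * r2 * norm z)).
    + eapply Rle_trans; [apply (blin_bound_le (T2 s) (snd v) K2 (hK2 s ltac:(lra)))|].
      now apply Rmult_le_compat_l.
    + apply Rle_trans with ((K2 + kappa) * (M2 * r2 * norm z)); [apply Rmult_le_compat_r; lra|].
      apply Rle_trans with (c2 * r2 * norm z); [apply Req_le; unfold c2; ring | lra].
Qed.

(** Approximating z by some x = A^-1 y costs at most e/2 by uniform boundedness, and T(t)x decays at
    the rate of T(t)A^-1. *)
Lemma block_strongly_stable : 0 < alpha1 -> 0 < alpha2 -> strongly_stable T.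
Proof.
  intros Hal1 Hal2 z.
  destruct block_bounded as [KT [HKT HT]].
  destruct block_decay as [c [Hc Hdec]].
  assert (hLL : is_bounded_inverse AA LL) by now apply block_inverse_correct.
  apply (proj2 (filterlim_norm_minus (Rbar_locally p_infty) (fun t => T t z) zero)); intros e He.
  destruct (block_domain_dense z (e / (2 * (KT + 1)))) as [x [[y Hxy] Hzx]].
  { apply Rdiv_lt_0_compat; lra. }
  apply Rmult_le_of_div in Hzx; [|lra].
  apply hLL in Hxy.
  assert (Hy := norm_ge_0 y).
  (* Two rates, each below [e'], contribute e/2 together. *)
  set (e' := e / (4 * (c + 1) * (norm y + 1))).
  assert (Hcy : 0 < (c + 1) * (norm y + 1)) by (apply Rmult_lt_0_compat; lra).
  assert (He' : 0 < e') by (apply Rdiv_lt_0_compat; lra).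
  destruct (Rpower_vanishes (1 / alpha1) e') as [t1 [Ht1 H1]]; trivial.
  { apply Rdiv_lt_0_compat; lra. }
  destruct (Rpower_vanishes (1 / alpha2) e') as [t2 [Ht2 H2]]; trivial.
  { apply Rdiv_lt_0_compat; lra. }
  exists (2 * (t1 + t2)); intros t Ht.
  specialize (H1 (t / 2) ltac:(lra)); specialize (H2 (t / 2) ltac:(lra)).
  assert (Hd := Hdec t ltac:(lra)).
  set (r1 := Rpower (t / 2) (- (1 / alpha1))) in *; set (r2 := Rpower (t / 2) (- (1 / alpha2))) in *.
  assert (Hx : norm (T t x) <= c * (r1 + r2) * norm y).
  { rewrite <- Hxy; exact (blin_bound_le (blin_comp (T t) LL) y _ Hd). }
  assert (Hx' : norm (T t x) < e / 2).
  { apply Rle_lt_trans with (1 := Hx).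
    assert (Hr1 : 0 < r1) by apply Rpower_pos; assert (Hr2 : 0 < r2) by apply Rpower_pos.
    apply Rle_lt_trans with ((c + 1) * (norm y + 1) * (r1 + r2)).
    - rewrite Rmult_assoc, (Rmult_comm _ (norm y)), <- Rmult_assoc.
      apply Rmult_le_compat_r; nra.
    - apply Rlt_le_trans with ((c + 1) * (norm y + 1) * (e' + e')).
      + apply Rmult_lt_compat_l; lra.
      + apply Req_le; unfold e'; field; lra. }
  assert (Hzx' := HT t (minus z x) ltac:(lra)).
  apply Rle_lt_trans with (norm (T t z)).
  { apply Req_le, norm_eq; vmod (prod_NormedModule C_AbsRing X1 X2). }
  assert (Hs := norm_le_minus (T t z) (T t x)); rewrite <- bminus in Hs.
  assert (Hn := norm_ge_0 (minus z x)).
  set (n := norm (minus z x)) in *.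
  assert (KT * n <= (KT + 1) * n) by (apply Rmult_le_compat_r; lra).
  apply Rle_lt_trans with (1 := Hs).
  apply Rle_lt_trans with (KT * n + norm (T t x)); [apply Rplus_le_compat_r; exact Hzx' | lra].
Qed.

End BlockSemigroup.

(** * The logarithmic rate and the conclusion *)

Lemma Rpower_log_bound p q t : 0 < q -> q <= p -> 3 <= t ->
  Rpower (t / 2) (- p) <= Rpower 2 q * Rpower (ln t / t) q.
Proof.
  intros Hq Hqp Ht.
  (* The threshold 3 exceeds e, which makes ln t at least 1, and makes t/2 at least 1 so that
     lowering the exponent from p to q weakens the bound. *)
  assert (Hln : 1 <= ln t).
  { rewrite <- (ln_exp 1); assert (H := exp_le_3).
    destruct (Rle_lt_or_eq_dec (exp 1) t ltac:(lra)) as [H1|H1].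
    - apply Rlt_le, ln_increasing; [apply exp_pos | trivial].
    - rewrite H1; lra. }
  apply Rle_trans with (Rpower (t / 2) (- q)).
  { apply Rle_Rpower; lra. }
  replace (Rpower (t / 2) (- q)) with (Rpower (2 / t) q).
  2:{ rewrite Rpower_Ropp, <- Rpower_Ropp; unfold Rpower; f_equal.
      unfold Rdiv; rewrite !ln_mult, !ln_Rinv by (try apply Rinv_0_lt_compat; lra); ring. }
  assert (Hi : 0 < / t) by (apply Rinv_0_lt_compat; lra).
  rewrite Rpower_mult_distr by (try lra; apply Rdiv_lt_0_compat; lra).
  apply Rle_Rpower_l; [lra|]; split; [apply Rdiv_lt_0_compat; lra|].
  unfold Rdiv; nra.
Qed.

Theorem theorem8
  (X1 X2 Y : CompleteNormedModule C_AbsRing)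
  (A1 : operator X1) (A2 : operator X2)
  (T1 : R -> blin X1 X1) (T2 : R -> blin X2 X2)
  (alpha1 alpha2 beta gamma : R)
  (B : blin Y X1) (Cop : blin X2 Y)
  (T : R -> blin (prod_NormedModule C_AbsRing X1 X2)
                 (prod_NormedModule C_AbsRing X1 X2))
  (hA1 : generates A1 T1) (hA2 : generates A2 T2)
  (halpha1 : 0 < alpha1) (halpha2 : 0 < alpha2)
  (hT1 : polynomially_stable A1 T1 alpha1)
  (hT2 : polynomially_stable A2 T2 alpha2)
  (hbeta : 0 <= beta) (hgamma : 0 <= gamma)
  (hB : forall y : Y, dom (frac_pow (op_opp A1) beta) (B y))
  (hC : forall phi : dual Y,
          dom (frac_pow (op_opp (adjoint A2)) gamma) (badjoint Cop phi))
  (hT : generates (block_op A1 (blin_comp B Cop) A2) T)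
  (hexp : beta / alpha1 + gamma / alpha2 > 1) :
  strongly_stable T /\
  exists Ainv : blin (prod_NormedModule C_AbsRing X1 X2)
                     (prod_NormedModule C_AbsRing X1 X2),
    is_bounded_inverse (block_op A1 (blin_comp B Cop) A2) Ainv /\
    exists M t0 : R, 1 <= M /\ 1 < t0 /\
      forall t : R, t0 <= t ->
        norm (blin_comp (T t) Ainv)
          <= M * Rpower (ln t / t) (1 / (alpha1 + alpha2)).
Proof.
  destruct (input_decay A1 T1 alpha1 beta B (seq_complete_CompleteNormedModule Y)
    hA1 halpha1 hT1 hbeta hB) as [k1 [hk1 hB']].
  destruct (output_decay A2 T2 alpha2 gamma Cop hA2 halpha2 hT2 hgamma hC) as [k2 [hk2 hC']].
  destruct (polynomially_stable_bounds A1 T1 alpha1 hT1) as [L1 [K1 [M1 [hL1 [hM1 [hK1 hd1]]]]]].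
  destruct (polynomially_stable_bounds A2 T2 alpha2 hT2) as [L2 [K2 [M2 [hL2 [hM2 [hK2 hd2]]]]]].
  assert (ha : 0 <= beta / alpha1) by (apply Rmult_le_pos; [trivial | apply Rlt_le, Rinv_0_lt_compat; trivial]).
  assert (hb : 0 <= gamma / alpha2) by (apply Rmult_le_pos; [trivial | apply Rlt_le, Rinv_0_lt_compat; trivial]).
  assert (hX1 := seq_complete_CompleteNormedModule X1).
  assert (hX2 := seq_complete_CompleteNormedModule X2).
  split.
  { eapply (block_strongly_stable hX1 hX2 A1 A2 T1 T2 hA1 hA2 L1 L2 hL1 hL2 B Cop T hT K1 K2 hK1 hK2
      _ _ k1 k2 ha hb hexp hk1 hk2 hB' hC' M1 M2 alpha1 alpha2); trivial. }
  destruct (block_decay hX1 hX2 A1 A2 T1 T2 hA1 hA2 L1 L2 hL1 hL2 B Cop T hT K1 K2 hK1 hK2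
      _ _ k1 k2 ha hb hexp hk1 hk2 hB' hC' M1 M2 alpha1 alpha2 hM1 hM2 hd1 hd2) as [c [Hc Hdec]].
  exists (block_inverse L1 (blin_comp B Cop) L2); split; [now apply block_inverse_correct|].
  set (q := 1 / (alpha1 + alpha2)).
  assert (Hq : 0 < q) by (apply Rdiv_lt_0_compat; lra).
  assert (Hq1 : q <= 1 / alpha1).
  { unfold q, Rdiv; rewrite !Rmult_1_l; apply Rinv_le_contravar; lra. }
  assert (Hq2 : q <= 1 / alpha2).
  { unfold q, Rdiv; rewrite !Rmult_1_l; apply Rinv_le_contravar; lra. }
  assert (H2q := Rpower_pos 2 q).
  (* Both powers are at most 2^q times the stated rate, whence 2 c 2^q; the summand 1 secures M >=
     1. *)
  exists (1 + 2 * c * Rpower 2 q), 3; split; [|split; [lra|]].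
  { assert (0 <= c * Rpower 2 q) by (apply Rmult_le_pos; lra); lra. }
  intros t Ht.
  assert (B1 := Rpower_log_bound (1 / alpha1) q t Hq Hq1 Ht).
  assert (B2 := Rpower_log_bound (1 / alpha2) q t Hq Hq2 Ht).
  assert (Hr := Rpower_pos (ln t / t) q).
  set (r := Rpower (ln t / t) q) in *.
  apply Rle_trans with (1 := Hdec t ltac:(lra)).
  apply Rle_trans with (c * (Rpower 2 q * r + Rpower 2 q * r)).
  - apply Rmult_le_compat_l; lra.
  - replace ((1 + 2 * c * Rpower 2 q) * r) with (r + c * (Rpower 2 q * r + Rpower 2 q * r)) by ring; lra.
Qed.
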